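(* Suppose that $2<p<\infty$. Then there is no positive number $K$ such that $$\big\|[\varphi(A,B),R]\big\|_{\boldsymbol S_p}\le K\,\|\varphi\|_{B^1_{\infty,1}(\mathbb R^2)}\max\big\{\|[A,R]\|_{\boldsymbol S_p},\,\|[B,R]\|_{\boldsymbol S_p}\big\}$$ whenever $\varphi\in B^1_{\infty,1}(\mathbb R^2)$, $R$ is a bounded linear operator, and $A$ and $B$ are finite rank self-adjoint operators on Hilbert space (with $A$, $B$, $R$ acting on the same, arbitrary, Hilbert space).
   Context: $[X,Y]=XY-YX$; $\boldsymbol S_p$ is the Schatten--von Neumann class. Homogeneous Besov class $B^1_{\infty,1}(\mathbb R^2)$. Let $w\ge0$ be a $C^\infty$ function on $(0,\infty)$ supported in $[1/2,2]$ with $w(s)=1-w(s/2)$ for $s\in[1,2]$, so that $\sum_{n\in\mathbb Z}w(2^{-n}s)=1$ for $s>0$. Let $W_n$ be the function on $\mathbb R^2$ with Fourier transform $w(2^{-n}\|\xi\|)$ and put $\varphi_n=\varphi*W_n$. Then $\varphi\in B^1_{\infty,1}(\mathbb R^2)$ if $\varphi$ is a tempered distribution with $\|\varphi\|_{B^1_{\infty,1}}:=\sum_{n\in\mathbb Z}2^n\|\varphi_n\|_{L^\infty}<\infty$ and $\nabla\varphi=\sum_{n\in\mathbb Z}\nabla\varphi_n$ (so $\varphi$ is determined by the $\varphi_n$ up to an additive constant; nonconstant polynomials are excluded). Such $\varphi$ are continuously differentiable functions. Functional calculus: $\varphi(A,B)=\iint\varphi(x,y)\,dE_A(x)\,dE_B(y)$,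 where $E_A,E_B$ are the spectral measures; for finite rank self-adjoint $A,B$ this is the finite sum $\sum_{\lambda\in\sigma(A)}\sum_{\mu\in\sigma(B)}\varphi(\lambda,\mu)E_A(\{\lambda\})E_B(\{\mu\})$. *)

(* Defs.v *)
From HB Require Import structures.
From mathcomp Require Export all_boot all_order all_algebra sesquilinear.
From mathcomp Require Export complex.
From mathcomp Require Export all_classical all_reals all_analysis.

Set Implicit Arguments.
Unset Strict Implicit.
Unset Printing Implicit Defensive.

Export Order.TTheory GRing.Theory Num.Theory.
Export numFieldNormedType.Exports.

Local Open Scope classical_set_scope.
Local Open Scope complex_scope.
Local Open Scope ring_scope.

Section Plane.
Context {R : realType}.
Implicit Types (f psi : R * R -> R[i]) (x xi : R * R) (u : (R * R -> R[i]) -> R[i]).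

Definition mu2 := (@lebesgue_measure R \x @lebesgue_measure R)%E.

Definition reF f : R * R -> R := fun x => complex.Re (f x).
Definition imF f : R * R -> R := fun x => complex.Im (f x).

(* The library modulus takes values in R[i]. *)
Definition cmod (z : R[i]) : R := complex.Re `|z|.

Definition cintegrable f : Prop :=
  mu2.-integrable setT (EFin \o reF f) /\ mu2.-integrable setT (EFin \o imF f).

Definition cint f : R[i] :=
  (\int[mu2]_x reF f x)%R +i* (\int[mu2]_x imF f x)%R.

(* The library norm on R * R is the sup norm. *)
Definition dotp x y : R := x.1 * y.1 + x.2 * y.2.
Definition enorm x : R := Num.sqrt (dotp x x).

Definition cis (t : R) : R[i] := cos t +i* sin t.

Definition fourier f xi : R[i] := cint (fun x => f x * cis (- dotp x xi)).

Definition dir (d : bool) : R * R := if d then (0, 1) else (1, 0).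

(* partial derivative with respect to the first (d = false) or the second
   (d = true) variable *)
Definition partial (d : bool) f : R * R -> R[i] :=
  fun x => ('D_(dir d) (reF f) x) +i* ('D_(dir d) (imF f) x).

Definition partials (s : seq bool) f : R * R -> R[i] := foldr partial f s.

Definition cdifferentiable f : Prop :=
  forall x, differentiable (reF f) x /\ differentiable (imF f) x.

Definition C1 f : Prop :=
  cdifferentiable f /\
  forall d, continuous (reF (partial d f)) /\ continuous (imF (partial d f)).

Definition smooth f : Prop := forall s, cdifferentiable (partials s f).

Definition schwartz f : Prop :=
  smooth f /\
  forall (s : seq bool) (k : nat), exists M : R,
    forall x, (1 + enorm x) ^+ k * cmod (partials s f x) <= M.

(* A functional is only meaningful on Schwartz functions; its values elsewhere
   are irrelevant.  Continuity is expressed by the seminorms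
   max_{|s| <= N} sup_x (1 + |x|)^N |D^s psi(x)|. *)
Definition tempered_distribution u : Prop :=
  (forall (a : R[i]) f psi, schwartz f -> schwartz psi ->
     u (fun x => a * f x + psi x) = a * u f + u psi) /\
  exists (N : nat) (C : R), forall psi (M : R), schwartz psi ->
    (forall s : seq bool, (size s <= N)%N ->
       forall x, (1 + enorm x) ^+ N * cmod (partials s psi x) <= M) ->
    cmod (u psi) <= C * M.

Definition distr_of f : (R * R -> R[i]) -> R[i] :=
  fun psi => cint (fun x => f x * psi x).

Definition deriv_distr (d : bool) u : (R * R -> R[i]) -> R[i] :=
  fun psi => - u (partial d psi).

Definition conv_distr u f : R * R -> R[i] := fun x => u (fun y => f (x - y)).

End Plane.

Section Besov.
Context {R : realType}.
Implicit Types (f psi : R * R -> R[i]) (u : (R * R -> R[i]) -> R[i]).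
Implicit Type W : int -> R * R -> R[i].

(* w is a function on (0, oo), extended by 0 to the whole line; the extension
   fixes the value at xi = 0 in dyadic_kernels. *)
Definition dyadic_window (w : R -> R) : Prop :=
  [/\ forall t, 0 <= w t,
      forall (n : nat) t, 0 < t -> derivable (derive1n n w) t 1,
      forall t, w t != 0 -> 2^-1 <= t <= 2
    & forall s, 1 <= s <= 2 -> w s = 1 - w (s / 2)].

Definition dyadic_kernels (w : R -> R) W : Prop :=
  forall n : int, schwartz (W n) /\
    forall xi, fourier (W n) xi = (w ((2 : R) ^ (- n) * enorm xi))%:C.

Definition besov_norm W u : \bar R :=
  (\esum_(n in [set: int])
     (((2 : R) ^ n)%:E *
      'N[mu2]_+oo[EFin \o cmod \o conv_distr u (W n)]))%E.

Definition ccvg (z : nat -> R[i]) (l : R[i]) : Prop :=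
  (fun N => cmod (z N - l)) @ \oo --> (0 : R).

(* The two-sided series is summed over -N <= n < N; in the last clause both
   sides are tempered distributions, tested against Schwartz functions. *)
Definition besov W u : Prop :=
  [/\ tempered_distribution u,
      (besov_norm W u < +oo)%E
    & forall (d : bool) psi, schwartz psi ->
        ccvg (fun N : nat => \sum_(k < N)
                 (distr_of (partial d (conv_distr u (W k%:Z))) psi +
                  distr_of (partial d (conv_distr u (W (- k.+1%:Z)))) psi))
             (deriv_distr d u psi)].

(* elements of the class, as continuously differentiable functions *)
Definition besov_function W f : Prop :=
  [/\ C1 f,
      forall psi, schwartz psi -> cintegrable (fun x => f x * psi x)
    & besov W (distr_of f)].

End Besov.

Record hilbertType (R : realType) := HilbertType {
  hilbert_sort :> completeNormedModType R[i];
  hdot : {dot hilbert_sort for (@Num.conj R[i])};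
  hdot_norm : forall x : hilbert_sort, hdot x x = `|x| ^+ 2 }.

Section Operators.
Context {R : realType} {H : hilbertType R}.
Implicit Types (S T : H -> H).

Definition bounded_op T : Prop :=
  exists M : R, forall x, `|T x| <= M%:C * `|x|.

Definition self_adjoint T : Prop :=
  forall x y, hdot H (T x) y = hdot H x (T y).

Definition rank_le (n : nat) T : Prop :=
  exists e : 'I_n -> H, forall x, exists c : 'I_n -> R[i],
    T x = \sum_i c i *: e i.

Definition finite_rank T : Prop := exists n, rank_le n T.

Definition commutator S T : H -> H := fun x => S (T x) - T (S x).

Definition opnorm T : \bar R :=
  ereal_sup [set (complex.Re `|T x|)%:E | x in [set x : H | `|x| <= 1]].

Definition singular_value (j : nat) T : \bar R :=
  ereal_inf [set opnorm (fun x => T x - K x) |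
               K in [set K : {linear H -> H} | bounded_op K /\ rank_le j K]].

Definition schatten_norm (p : R) T : \bar R :=
  ((\sum_(0 <= j <oo) singular_value j T `^ p) `^ p^-1)%E.

(* The spectrum of a self-adjoint operator is real. *)
Definition spectrum T : set R :=
  [set l | ~ exists S : {linear H -> H}, [/\ bounded_op S,
      forall x, S (T x - l%:C *: x) = x
    & forall x, T (S x) - l%:C *: S x = x]].

(* Only meaningful when V is a closed subspace. *)
Definition orth_proj (V : set H) (x : H) : H :=
  xget 0 [set y | V y /\ forall v, V v -> hdot H (x - y) v = 0].

(* E_T({l}) for a self-adjoint T: the projection onto the eigenspace, which is
   0 unless l is an eigenvalue *)
Definition spectral_proj T (l : R) : H -> H :=
  orth_proj [set x | T x = l%:C *: x].

(* The spectra of finite rank self-adjoint operators are finite, so these are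
   genuine finite sums. *)
Definition fcalc (phi : R * R -> R[i]) (A B : H -> H) : H -> H := fun x =>
  \sum_(l \in spectrum A) \sum_(m \in spectrum B)
    phi (l, m) *: spectral_proj A l (spectral_proj B m x).

End Operators.

(* Main.v *)
From HB Require Import structures.
Require Import Defs.
From mathcomp Require Import measurable_realfun ess_sup_inf ring lra zify.
Local Open Scope ring_scope.

(** The counterexample lives on [C^n (x) C^2].  Let [A = diag(j) (x) 1], let [B]
    have the eigenvalues [2k], [2k+1] on [g_k (x) e_0], [g_k (x) e_1], where [g_k]
    is the discrete Fourier basis, and let [T] flip the factor [C^2].  Then
    [[A, T] = 0] and [[B, T]] is an isometry of a space of dimension [2n], so the
    right-hand side has Schatten norm at most [(2n)^(1/p)].  In the bases [f_j],
    [g_k] the operator [phi(A, B)] is a Schur product with a matrix whose entries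
    have modulus [n^(-1/2)]; choosing [phi(j, 2k)] to be the conjugate phases and
    [phi(j, 2k+1) = 0] gives a rank one operator of norm [n^(1/2)], and so
    [[phi(A, B), T]] has norm at least [n^(1/2)], which is not [O(n^(1/p))].

    Such a [phi] exists with bounded Besov norm: interpolate the values on the
    integer grid by periodic Fejer kernels, which are nonnegative and sum to [1],
    so that [|phi| <= 1], and whose frequencies are bounded independently of [n].
    For a trigonometric polynomial [phi], the function [phi * W_n] depends only on
    the Fourier transform of [W_n], which is a dilation of that of [W_0]; hence
    [|phi * W_n| <= C] with [C] depending only on [W_0], and [phi * W_n = 0] for
    large [n]. *)

Set Implicit Arguments.
Unset Strict Implicit.
Unset Printing Implicit Defensive.
Local Open Scope classical_set_scope.
Local Open Scope complex_scope.
Local Open Scope ring_scope.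

(** * Finite-dimensional Hilbert spaces *)

Definition ell2 (R : realType) (I : finType) : Type := {ffun I -> R[i]^o}.

(** * Comparison of the modulus with real and imaginary parts *)

Section ComplexModulus.
Context {R : realType}.
Implicit Type z : R[i].

Lemma normc_le_Re_Im z : `|z| <= (`|complex.Re z| + `|complex.Im z|)%:C.
Proof.
case: z => a b /=.
rewrite normc_def lecR -(@ler_pXn2r _ 2) ?nnegrE ?sqrtr_ge0 ?addr_ge0 //.
rewrite sqr_sqrtr ?addr_ge0 ?sqr_ge0 //=.
rewrite sqrrD !real_normK ?num_real // addrAC lerDl mulrn_wge0 //.
Qed.

Lemma Re_le_normc z : `|complex.Re z|%:C <= `|z|.
Proof.
case: z => a b /=; rewrite normc_def lecR -(@ler_pXn2r _ 2) ?nnegrE ?sqrtr_ge0 //.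
rewrite sqr_sqrtr ?addr_ge0 ?sqr_ge0 //=.
by rewrite real_normK ?num_real // lerDl sqr_ge0.
Qed.

Lemma Im_le_normc z : `|complex.Im z|%:C <= `|z|.
Proof.
case: z => a b /=; rewrite normc_def lecR -(@ler_pXn2r _ 2) ?nnegrE ?sqrtr_ge0 //.
rewrite sqr_sqrtr ?addr_ge0 ?sqr_ge0 //=.
by rewrite real_normK ?num_real // lerDr sqr_ge0.
Qed.

End ComplexModulus.

Section Ell2.
Context {R : realType} {I : finType}.
Local Notation C := (R[i]).
Local Notation L := (ell2 R I).

HB.instance Definition _ := Vector.copy L {ffun I -> C^o}.

Definition ell2_dot (x y : L) : C := \sum_i x i * (y i)^*.

Fact ell2_dot_bilinear :
  bilinear_for *%R (@Num.conj C \; *%R) ell2_dot.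
Proof.
split=> u a x y; rewrite /ell2_dot /=.
  rewrite mulr_sumr -big_split /=; apply: eq_bigr => i _.
  by rewrite !ffunE /= mulrDl mulrA.
rewrite mulr_sumr -big_split /=; apply: eq_bigr => i _.
by rewrite !ffunE /= rmorphD rmorphM /= mulrDr; congr (_ + _); rewrite mulrCA.
Qed.

HB.instance Definition _ :=
  bilinear_isBilinear.Build C L L C *%R (@Num.conj C \; *%R) ell2_dot
    ell2_dot_bilinear.

Fact ell2_dot_hermitian (x y : L) :
  ell2_dot x y = (-1) ^+ false * (ell2_dot y x)^*.
Proof.
rewrite expr0 mul1r /ell2_dot rmorph_sum; apply: eq_bigr => i _.
by rewrite rmorphM /= conjCK mulrC.
Qed.

HB.instance Definition _ := @isHermitianSesquilinear.Build C L false (@Num.conj C)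
  ell2_dot ell2_dot_hermitian.

Fact ell2_dot_gt0 (x : L) : x != 0 -> 0 < ell2_dot x x.
Proof.
move=> x0; have [i xi0] : exists i, x i != 0.
  apply/existsP; apply: contraNT x0 => /existsPn h.
  by apply/eqP/ffunP => i; rewrite ffunE; apply/eqP/negPn/h.
rewrite /ell2_dot (bigD1 i) //= ltr_wpDr ?sumr_ge0 //.
  by move=> j _; rewrite -normCK exprn_ge0.
by rewrite -normCK exprn_gt0 // normr_gt0.
Qed.

HB.instance Definition _ := isDotProduct.Build C L ell2_dot ell2_dot_gt0.

Definition ell2_norm (x : L) : C := sqrtC (ell2_dot x x).

Fact ell2_norm_triangle x y : ell2_norm (x + y) <= ell2_norm x + ell2_norm y.
Proof. exact: (triangle_lerif (ell2_dot : {dot L for @Num.conj C})). Qed.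

Fact ell2_normZ a x : ell2_norm (a *: x) = `|a| * ell2_norm x.
Proof.
rewrite /ell2_norm linearZl linearZr /= mulrA -normCK.
by rewrite rootCMl ?exprn_ge0 // sqrCK.
Qed.

Fact ell2_norm0_eq0 x : ell2_norm x = 0 -> x = 0.
Proof.
move/eqP; rewrite sqrtC_eq0 => h; apply/eqP; apply: contraT => x0.
by have := ell2_dot_gt0 x0; rewrite (eqP h) ltxx.
Qed.

HB.instance Definition _ := Lmodule_isNormed.Build C L
  ell2_norm_triangle ell2_normZ ell2_norm0_eq0.

Fact ell2_normE (x : L) : `|x| = ell2_norm x. Proof. by []. Qed.

Fact ell2_norm_sqr (x : L) : ell2_dot x x = `|x| ^+ 2.
Proof. by rewrite ell2_normE sqrtCK. Qed.

Lemma ell2_norm_coord (x : L) i : `|x i| <= `|x|.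
Proof.
rewrite -(@ler_pXn2r _ 2) ?nnegrE ?normr_ge0 // -ell2_norm_sqr.
rewrite /ell2_dot (bigD1 i) //= -normCK lerDl sumr_ge0 // => j _.
by rewrite -normCK exprn_ge0.
Qed.

Lemma ell2_norm_le_sum (x : L) : `|x| <= \sum_i `|x i|.
Proof.
rewrite -(@ler_pXn2r _ 2) ?nnegrE ?normr_ge0 ?sumr_ge0 //.
rewrite -ell2_norm_sqr expr2 mulr_suml; apply: ler_sum => i _.
rewrite -normCK expr2 ler_wpM2l // (bigD1 i) //= lerDl sumr_ge0 //.
Qed.

(** A function that does not increase distances maps Cauchy filters to Cauchy filters, and the real
    line is complete. *)
Lemma cauchy_real_image (F : set_system L) (g : L -> R) :
  (forall x y, `|g x - g y|%:C <= `|x - y|) -> ProperFilter F -> cauchy F ->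
  cvg (g @ F).
Proof.
move=> gle FF Fc; apply: R_complete; apply/cauchy_ballP => e e0.
have e0' : 0 < e%:C :> C by rewrite ltcR.
have /cauchy_ballP/(_ _ e0') h := Fc.
rewrite near_simpl.
apply: filterS h => -[x y] /= h; rewrite /ball /= -ltcR.
exact: le_lt_trans (gle x y) h.
Qed.

(** The limit is built coordinatewise: real and imaginary parts of a coordinate are bounded by the
    norm, and conversely the norm is bounded by the sum of the moduli of the coordinates. *)
Fact ell2_complete (F : set_system L) : ProperFilter F -> cauchy F -> cvg F.
Proof.
move=> FF Fc.
have cRe i : cvg ((fun x : L => complex.Re (x i)) @ F).
  apply: cauchy_real_image => // x y; rewrite -raddfB /=.
  apply: le_trans (Re_le_normc _) _.
  by have := ell2_norm_coord (x - y) i; rewrite !ffunE.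
have cIm i : cvg ((fun x : L => complex.Im (x i)) @ F).
  apply: cauchy_real_image => // x y; rewrite -raddfB /=.
  apply: le_trans (Im_le_normc _) _.
  by have := ell2_norm_coord (x - y) i; rewrite !ffunE.
pose l : L := [ffun i => lim ((fun x : L => complex.Re (x i)) @ F) +i*
                          lim ((fun x : L => complex.Im (x i)) @ F)].
apply/cvg_ex; exists l; apply/cvgrPdist_le => e e0.
(* In the order of [R[i]] a positive number is real. *)
have [u er] : exists u : R, e = u%:C.
  by exists (complex.Re e); case: e e0 => a b; rewrite ltcE /= => /andP[/eqP -> _].
have u0 : 0 < u by move: e0; rewrite er ltcR.
(* The error [u] is shared among twice [#|I|] real coordinates; the successor keeps the denominator
   nonzero when [I] is empty. *)
pose d := u / (2 * (#|I|.+1)%:R).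
have d0 : 0 < d by rewrite divr_gt0 // mulr_gt0.
have near_all (g : I -> L -> R) (m : I -> R) : (forall i, g i @ F --> m i) ->
    \forall x \near F, forall i, `|m i - g i x| <= d.
  move=> gm; apply: filter_forall => i.
  by have /cvgrPdist_le/(_ _ d0) := gm i.
near=> x.
apply: le_trans (ell2_norm_le_sum _) _.
apply: (@le_trans _ _ (\sum_(i : I) (d + d)%:C)).
  apply: ler_sum => i _; apply: le_trans (normc_le_Re_Im _) _; rewrite lecR.
  rewrite !ffunE /= !raddfD /= !raddfN /=; apply: lerD.
    by move: (i); near: x; apply: near_all => j; exact: cRe.
  by move: (i); near: x; apply: near_all => j; exact: cIm.
rewrite sumr_const -rmorphMn /= er lecR.
have small (n : nat) (v : R) : 0 < v ->
    (v / (2 * n.+1%:R) + v / (2 * n.+1%:R)) *+ n <= v.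
  move=> v0; have -> : v / (2 * n.+1%:R) + v / (2 * n.+1%:R) = v / n.+1%:R.
    have /eqP k0 : n.+1%:R != 0 :> R by rewrite pnatr_eq0.
    by field.
  by rewrite -mulr_natr mulrAC ler_pdivrMr ?ltr0n // ler_pM2l // ler_nat.
exact: small.
Unshelve. all: by end_near. Qed.

HB.instance Definition _ := Uniform_isComplete.Build L ell2_complete.

Definition ell2_hilbert : hilbertType R :=
  @HilbertType R (ell2 R I) (ell2_dot : {dot L for @Num.conj C}) ell2_norm_sqr.

End Ell2.
Arguments ell2_hilbert : clear implicits.

(** * Orthonormal bases, functional calculus and Schatten norms *)

Section OrthonormalBasis.
Context {R : realType} {H : hilbertType R} {I : finType}.
Local Notation C := (R[i]).
Implicit Types (f g : I -> H) (x y : H) (s : I -> I) (c : I -> C).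

(** Completeness is stated as the expansion of every vector, so that Parseval's identity follows by
    bilinearity alone. *)
Definition orthonormal_basis f : Prop :=
  (forall i j, hdot H (f i) (f j) = (i == j)%:R) /\
  (forall x, x = \sum_i hdot H x (f i) *: f i).

Lemma hdotDl x x' y : hdot H (x + x') y = hdot H x y + hdot H x' y.
Proof. exact: linearDl. Qed.
Lemma hdotZl a x y : hdot H (a *: x) y = a * hdot H x y.
Proof. exact: linearZl. Qed.
Lemma hdotNl x y : hdot H (- x) y = - hdot H x y.
Proof. exact: linearNl. Qed.
Lemma hdot0l y : hdot H 0 y = 0.
Proof. exact: linear0l. Qed.
Lemma hdot_suml (J : Type) (r : seq J) (P : pred J) (F : J -> H) y :
  hdot H (\sum_(j <- r | P j) F j) y = \sum_(j <- r | P j) hdot H (F j) y.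
Proof. by apply: (big_morph (fun x => hdot H x y)) => [a b|]; rewrite ?hdotDl ?hdot0l. Qed.
Lemma hdot_sym x y : hdot H x y = (hdot H y x)^*.
Proof. by rewrite (@hermitian_subproof _ _ _ _ (hdot H)) expr0 mul1r. Qed.

Lemma hdot_norm_eq0 x : hdot H x x = 0 -> x = 0.
Proof. by move/eqP; rewrite hdot_norm sqrf_eq0 normr_eq0 => /eqP. Qed.

Section Fixed.
Variables (f : I -> H) (fP : orthonormal_basis f).

Lemma hdot_basis_sum (c : I -> C) (P : pred I) i :
  hdot H (\sum_(j | P j) c j *: f j) (f i) = if P i then c i else 0.
Proof.
rewrite hdot_suml big_mkcond (bigD1 i) //= big1 ?addr0.
  by case: (P i) => //; rewrite hdotZl fP.1 eqxx mulr1.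
by move=> j /negPf ji; case: ifP => // _; rewrite hdotZl fP.1 ji mulr0.
Qed.

Lemma basis_eq x y : (forall i, hdot H x (f i) = hdot H y (f i)) -> x = y.
Proof. by move=> h; rewrite (fP.2 x) (fP.2 y); apply: eq_bigr => i _; rewrite h. Qed.

Lemma parseval_dot x y :
  hdot H x y = \sum_i hdot H x (f i) * (hdot H y (f i))^*.
Proof.
rewrite {1}(fP.2 x) hdot_suml; apply: eq_bigr => i _.
by rewrite hdotZl (hdot_sym (f i)).
Qed.

Lemma parseval x : `|x| ^+ 2 = \sum_i `|hdot H x (f i)| ^+ 2.
Proof.
by rewrite -hdot_norm parseval_dot; apply: eq_bigr => i _; rewrite -normCK.
Qed.

(* Sends the basis vector [f i] to [c i *: f (s i)]. *)
Definition wperm s c x : H := \sum_i (c i * hdot H x (f i)) *: f (s i).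

Fact wperm_linear s c : linear (wperm s c).
Proof.
move=> a x y; rewrite /wperm scaler_sumr -big_split /=; apply: eq_bigr => i _.
by rewrite hdotDl hdotZl mulrDr scalerDl scalerA mulrCA.
Qed.
HB.instance Definition _ s c := GRing.isLinear.Build C H H *:%R (wperm s c)
  (wperm_linear s c).

Lemma wperm_basis s c i : wperm s c (f i) = c i *: f (s i).
Proof.
rewrite /wperm (bigD1 i) //= fP.1 eqxx mulr1 big1 ?addr0 // => j /negPf ji.
by rewrite fP.1 eq_sym ji mulr0 scale0r.
Qed.

Lemma linear_basis_eq (S T : {linear H -> H}) :
  (forall i, S (f i) = T (f i)) -> S =1 T.
Proof.
move=> h x; rewrite (fP.2 x) !linear_sum; apply: eq_bigr => i _.
by rewrite !linearZ h.
Qed.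

(** Injectivity of [s] keeps the image vectors [f (s i)] orthonormal, so this is Pythagoras. *)
Lemma norm_wperm s c x : injective s ->
  `|wperm s c x| ^+ 2 = \sum_i `|c i| ^+ 2 * `|hdot H x (f i)| ^+ 2.
Proof.
move=> sI; rewrite -hdot_norm /wperm hdot_suml.
apply: eq_bigr => i _; rewrite hdotZl (hdot_sym (f (s i))).
have -> : hdot H (\sum_j (c j * hdot H x (f j)) *: f (s j)) (f (s i)) =
          c i * hdot H x (f i).
  rewrite hdot_suml (bigD1 i) //= hdotZl fP.1 eqxx mulr1 big1 ?addr0 // => j ji.
  by rewrite hdotZl fP.1 (inj_eq sI) (negPf ji) mulr0.
by rewrite -normCK normrM exprMn.
Qed.

Lemma wperm_le s c (M : R) x : injective s -> 0 <= M -> (forall i, `|c i| <= M%:C) ->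
  `|wperm s c x| <= M%:C * `|x|.
Proof.
move=> sI M0 cM; have M0' : 0 <= M%:C :> C by rewrite lecR.
rewrite -(@ler_pXn2r _ 2) ?nnegrE ?mulr_ge0 // exprMn norm_wperm // parseval.
rewrite mulr_sumr; apply: ler_sum => i _.
by rewrite ler_wpM2r ?exprn_ge0 // ler_pXn2r ?nnegrE.
Qed.

Lemma normc_real (z : C) : `|z| = (cmod z)%:C.
Proof. by rewrite /cmod normc_def. Qed.

Lemma wperm_bounded s c : injective s -> bounded_op (wperm s c).
Proof.
move=> sI; exists (\sum_i cmod (c i)) => x; apply: wperm_le => //.
  by apply: sumr_ge0 => i _; rewrite -lecR -normc_real normr_ge0.
move=> i; rewrite normc_real lecR (bigD1 i) //= lerDl sumr_ge0 // => j _.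
by rewrite -lecR -normc_real normr_ge0.
Qed.

Lemma wperm_rank_le s c : rank_le #|I| (wperm s c).
Proof.
exists (fun k : 'I_#|I| => f (s (enum_val k))) => x.
exists (fun k : 'I_#|I| => c (enum_val k) * hdot H x (f (enum_val k))).
rewrite /wperm (reindex (@enum_val I predT)) //=.
exact: onW_bij (enum_val_bij _).
Qed.

Definition basis_diag (a : I -> R) : H -> H := wperm id (fun i => (a i)%:C).

Lemma wperm_idE c x i : hdot H (wperm id c x) (f i) = c i * hdot H x (f i).
Proof. by rewrite hdot_basis_sum. Qed.

Lemma basis_diag_self_adjoint (a : I -> R) : self_adjoint (basis_diag a).
Proof.
move=> x y; rewrite (parseval_dot (basis_diag a x)) (parseval_dot x).
apply: eq_bigr => i _; rewrite !wperm_idE rmorphM /= mulrCA mulrA.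
by congr (_ * _ * _); apply/esym/CrealP; apply/complex_realP; exists (a i).
Qed.

(** Away from the values of [a] the resolvent is diagonal in the same basis. Duplicates are removed
    because the sums in [fcalc] run over distinct eigenvalues. *)
Lemma spectrum_basis_diag (a : I -> R) :
  spectrum (basis_diag a) = [set` undup (codom a)].
Proof.
apply/seteqP; split => l /=; rewrite mem_undup.
  move=> nS; apply: contrapT => /negP la; apply: nS.
  have nz i : (a i)%:C - l%:C != 0 :> C.
    rewrite -rmorphB /=; apply: contra la => /eqP [] /eqP.
    by rewrite subr_eq0 => /eqP <-; apply: codom_f.
  exists (wperm id (fun i => ((a i)%:C - l%:C)^-1)); split.
  - exact: wperm_bounded.
  - move=> x; apply: basis_eq => i.
    by rewrite wperm_idE hdotDl hdotNl hdotZl wperm_idE -mulrBl mulrA mulVf // mul1r.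
  - move=> x; apply: basis_eq => i.
    by rewrite hdotDl hdotNl hdotZl !wperm_idE -mulrBl mulrA mulfV // mul1r.
case/codomP => i ->{l} [S [_ h _]].
(* A left inverse of the operator minus [a i] would give [f i = S 0 = 0], although [f i] is a unit
   vector. *)
have := h (f i); rewrite /basis_diag wperm_basis subrr linear0 => fi0.
have := fP.1 i i; rewrite -fi0 hdot0l eqxx => /eqP.
by rewrite eq_sym oner_eq0.
Qed.

(** The sum lies in the eigenspace [V] and its difference from [x] is orthogonal to [V]; these two
    properties determine the projection. *)
Lemma spectral_proj_basis_diag (a : I -> R) (l : R) x :
  spectral_proj (basis_diag a) l x = \sum_(i | a i == l) hdot H x (f i) *: f i.
Proof.
set P := \sum_(i | _) _.
set V := [set z | basis_diag a z = l%:C *: z].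
have Vc z i : V z -> (a i)%:C * hdot H z (f i) = l%:C * hdot H z (f i).
  by move=> /(congr1 (fun z => hdot H z (f i))); rewrite wperm_idE hdotZl.
have VP z : V z -> forall i, a i != l -> hdot H z (f i) = 0.
  move=> Vz i al; apply/eqP; have /eqP := Vc z i Vz.
  rewrite -subr_eq0 -mulrBl mulf_eq0.
  case/orP => [|/eqP -> //]; rewrite -rmorphB fmorph_eq0 subr_eq0 (negPf al) //.
have VPP : V P.
  apply: basis_eq => i; rewrite wperm_idE hdotZl hdot_basis_sum.
  by case: ifP => [/eqP -> //|]; rewrite !mulr0.
have oP v : V v -> hdot H (x - P) v = 0.
  move=> Vv; rewrite parseval_dot big1 // => i _.
  have [ai|/(VP _ Vv) ->] := eqVneq (a i) l; last by rewrite rmorph0 mulr0.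
  by rewrite hdotDl hdotNl hdot_basis_sum ai eqxx subrr mul0r.
rewrite /spectral_proj /orth_proj.
(* The default value of [xget] does not occur, since [P] is a candidate. *)
case: xgetP => [y _ [Vy oy]|]; last by move/(_ P); case.
apply/eqP; rewrite -subr_eq0; apply/eqP/hdot_norm_eq0.
have Vd : V (y - P).
  apply: basis_eq => i; rewrite wperm_idE hdotZl hdotDl hdotNl mulrBr.
  by rewrite !Vc // -mulrBr.
(* A difference of two vectors orthogonal to [V]; as [y - P] also lies in [V], it is orthogonal to
   itself. *)
have {1}-> : y - P = (x - P) - (x - y) by rewrite opprB [RHS]addrC addrA subrK.
by rewrite hdotDl hdotNl oP // oy // subrr.
Qed.

End Fixed.

(** The index set splits into the fibres of [a]: this converts sums over distinct eigenvalues into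
    sums over basis vectors, whatever the multiplicities. *)
Lemma sum_undup_codom (T : eqType) (V : nmodType) (a : I -> T)
    (G : T -> I -> V) :
  \sum_(l <- undup (codom a)) \sum_(i | a i == l) G l i = \sum_i G (a i) i.
Proof.
rewrite (exchange_big_dep predT) //=; apply: eq_bigr => i _.
rewrite (eq_bigl (pred1 (a i))) => [|l]; last by rewrite /= eq_sym.
rewrite -big_filter filter_pred1_uniq ?undup_uniq ?mem_undup ?codom_f //.
by rewrite big_seq1.
Qed.

(** The double operator integral as a Schur product: its matrix from the basis [g] to the basis [f]
    is the transition matrix multiplied entrywise by the values of [phi]. *)
Lemma fcalc_basis_diag (phi : R * R -> C) f g (a b : I -> R) x :
  orthonormal_basis f -> orthonormal_basis g ->
  fcalc phi (basis_diag f a) (basis_diag g b) x =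
  \sum_i \sum_j (phi (a i, b j) * (hdot H x (g j) * hdot H (g j) (f i))) *: f i.
Proof.
move=> fP gP; rewrite /fcalc !spectrum_basis_diag // -fsbig_seq ?undup_uniq //.
rewrite -(sum_undup_codom a (fun l i => \sum_j (phi (l, b j) * _) *: f i)).
apply: eq_bigr => l _.
rewrite -fsbig_seq ?undup_uniq //.
under [RHS]eq_bigr => i _.
  rewrite -(sum_undup_codom b (fun m j =>
    (phi (l, m) * (hdot H x (g j) * hdot H (g j) (f i))) *: f i)).
  over.
rewrite exchange_big /=; apply: eq_bigr => m _.
rewrite !spectral_proj_basis_diag // scaler_sumr; apply: eq_bigr => i _.
rewrite hdot_suml scalerA mulr_sumr scaler_suml; apply: eq_bigr => j _.
by rewrite hdotZl.
Qed.

End OrthonormalBasis.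

(** * Bounds for singular values and Schatten norms *)

Lemma le_poweR (R : realType) (r : R) (x y : \bar R) :
  0 <= r -> (0 <= x)%E -> (x <= y)%E -> (x `^ r <= y `^ r)%E.
Proof.
move=> r0 x0 xy; apply: gt0_ler_poweR => //; rewrite in_itv /= leey andbT //.
exact: le_trans xy.
Qed.

Section SchattenBounds.
Context {R : realType} {H : hilbertType R}.
Implicit Types (S : H -> H) (T : {linear H -> H}).

Lemma opnorm_ge S x : `|x| <= 1 -> ((complex.Re `|S x|)%:E <= opnorm S)%E.
Proof. by move=> x1; apply: ereal_sup_ubound; exists x. Qed.

Lemma opnorm_ge0 S : S 0 = 0 -> (0 <= opnorm S)%E.
Proof.
by move=> S0; have := @opnorm_ge S 0; rewrite normr0 S0 normr0; apply.
Qed.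

Lemma singular_value_ge0 j S : S 0 = 0 -> (0 <= singular_value j S)%E.
Proof.
move=> S0; apply: le_ereal_inf_tmp => _ [K _ <-]; apply: opnorm_ge0.
by rewrite /= linear0 S0 subr0.
Qed.

Lemma singular_value_le j S : (singular_value j S <= opnorm S)%E.
Proof.
apply: ereal_inf_lbound; exists (\0 : {linear H -> H})%R.
  split; first by exists 0 => x; rewrite normr0 mul0r.
  by exists (fun=> 0) => x; exists (fun=> 0); rewrite big1 // => i _; rewrite scaler0.
by congr opnorm; apply/funext => x; rewrite subr0.
Qed.

Lemma singular_value0 S : (singular_value 0 S = opnorm S)%E.
Proof.
apply/eqP; rewrite eq_le singular_value_le /=.
apply: le_ereal_inf_tmp => _ [K [_ [e K0]] <-].
rewrite (_ : (fun x => _) = S) //; apply/funext => x.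
by have [c ->] := K0 x; rewrite big_ord0 subr0.
Qed.

(** [T] is itself an admissible approximation, with error 0. *)
Lemma singular_value_rank_le n j T : bounded_op T -> rank_le n T -> (n <= j)%N ->
  (singular_value j T = 0)%E.
Proof.
move=> bT [e rT] nj; apply/eqP; rewrite eq_le singular_value_ge0 ?linear0 // andbT.
apply: (@le_trans _ _ (opnorm (fun x => T x - T x))).
  apply: ereal_inf_lbound; exists T => //; split => //.
  (* The [n] spanning vectors are padded by zeros to a family of length [j]. *)
  exists (fun i => if insub (val i) is Some k then e k else 0) => x.
  have [c ->] := rT x.
  exists (fun i => if insub (val i) is Some k then c k else 0).
  rewrite -(subnKC nj) big_split_ord /= [X in _ + X]big1 ?addr0.
    by apply: eq_bigr => i _; rewrite valK.
  by move=> i _; case: insubP => [k|]; rewrite ?scale0r //= ltnNge leq_addr.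
apply: ge_ereal_sup => _ [x _ <-]; by rewrite subrr normr0.
Qed.

(** The operator norm is the singular value of index 0, one term of a nonnegative series. *)
Lemma opnorm_le_schatten (p : R) S : 0 < p -> S 0 = 0 ->
  (opnorm S <= schatten_norm p S)%E.
Proof.
move=> p0 S0; rewrite /schatten_norm.
have -> : opnorm S = ((singular_value 0 S `^ p) `^ p^-1)%E.
  rewrite -poweRrM divff ?lt0r_neq0 // poweRe1 ?singular_value_ge0 ?linear0 //.
  by rewrite singular_value0.
apply: le_poweR; rewrite ?invr_ge0 ?(ltW p0) ?poweR_ge0 //.
apply: (@le_trans _ _ (\sum_(0 <= j < 1) singular_value j S `^ p)%E).
  by rewrite big_nat1.
by apply: nneseries_lim_ge => *; apply: poweR_ge0.
Qed.

(** Only the first [n] singular values can be nonzero, and each is at most the operator norm. *)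
Lemma schatten_le_rank (p : R) n T : 0 < p -> bounded_op T -> rank_le n T ->
  (opnorm T <= 1)%E -> (schatten_norm p T <= (n%:R `^ p^-1)%:E)%E.
Proof.
move=> p0 bT rT T1; rewrite /schatten_norm -poweR_EFin.
have sv0 j : (0 <= singular_value j T `^ p)%E by exact: poweR_ge0.
apply: le_poweR; rewrite ?invr_ge0 ?(ltW p0) //.
  by apply: nneseries_ge0 => *; apply: poweR_ge0.
rewrite (nneseries_split 0 n) //.
rewrite eseries0 ?adde0; last first.
  move=> j nj _ /=; rewrite (singular_value_rank_le bT rT) ?poweR0r ?lt0r_neq0 //.
apply: (@le_trans _ _ (\sum_(0 <= j < 0 + n) 1)%E).
  apply: lee_sum => j _; rewrite -[leRHS](poweR1r p).
  apply: le_poweR; rewrite ?(ltW p0) ?singular_value_ge0 ?linear0 //.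
  exact: le_trans (singular_value_le _ _) T1.
by rewrite big_nat sumEFin -big_nat sumr_const_nat add0n subn0.
Qed.
End SchattenBounds.

(** * Roots of unity *)

Section Cis.
Context {R : realType}.
Local Notation C := (R[i]).
Implicit Types (s t : R).

Lemma cis0 : cis 0 = 1 :> C.
Proof. by rewrite /cis cos0 sin0. Qed.

Lemma cisD s t : cis (s + t) = cis s * cis t :> C.
Proof. by apply/eqP; rewrite eq_complex /= cosD sinD eqxx addrC eqxx. Qed.

Lemma conj_cis t : (cis t)^* = cis (- t) :> C.
Proof. by rewrite /cis cosN sinN. Qed.

Lemma cmod_cis t : cmod (cis t) = 1.
Proof. by rewrite /cmod normc_def /= cos2Dsin2 sqrtr1. Qed.

Lemma normr_cis t : `|cis t| = 1 :> C.
Proof. by rewrite normc_real cmod_cis. Qed.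

Lemma cisX t n : cis (t *+ n) = cis t ^+ n :> C.
Proof. by elim: n => [|n IH]; rewrite ?mulr0n ?cis0 // mulrS exprS cisD IH. Qed.

Lemma cis_2piMn n : cis (2 * pi *+ n) = 1 :> C.
Proof. by rewrite cisX mulr_natl /cis cos2pi sin2pi expr1n. Qed.

(** From [cos t = 1 - 2 sin(t/2)^2], where the sine is positive on the given range. *)
Lemma cis_neq1 t : 0 < t < 2 * pi -> cis t != 1 :> C.
Proof.
move=> /andP[t0 t2]; apply/eqP => /(congr1 (@complex.Re R)) /= c1.
have s0 : 0 < sin (t / 2) by apply: sin_gt0_pi; lra.
have := cos2Dsin2 (t / 2); have := cosD (t / 2) (t / 2).
have -> : t / 2 + t / 2 = t by field.
rewrite c1 => h1 h2; have := mulr_gt0 s0 s0; nra.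
Qed.

(** For distinct indices this is a geometric sum whose ratio is an [n]-th root of unity different
    from 1. *)
Lemma sum_cis_orth n (k l : 'I_n) :
  \sum_(j < n) cis (2 * pi * (k%:R - l%:R) / n%:R * j%:R) = (k == l)%:R * n%:R :> C.
Proof.
have [->|kl] := eqVneq k l.
  rewrite subrr mulr0 mul0r mul1r (eq_bigr (fun=> 1)) => [|j _].
    by rewrite sumr_const card_ord.
  by rewrite mul0r cis0.
have n0 : (0 < n)%N by case: n k l kl => // -[].
rewrite mul0r; set t := _ / _.
rewrite (eq_bigr (fun j : 'I_n => cis t ^+ j)); last first.
  by move=> j _; rewrite mulr_natr cisX.
have nz : n%:R != 0 :> R by rewrite pnatr_eq0 -lt0n.
have z1 (a b : 'I_n) : (b < a)%N -> cis (2 * pi * (a%:R - b%:R) / n%:R) != 1 :> C.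
  move=> ba; apply: cis_neq1; have p0 := pi_gt0 R.
  have ab : (b%:R : R) < a%:R by rewrite ltr_nat.
  have an : (a%:R : R) < n%:R by rewrite ltr_nat.
  have b0 : 0 <= (b%:R : R) by rewrite ler0n.
  rewrite divr_gt0 ?ltr0n // ?mulr_gt0 ?subr_gt0 // ltr_pdivrMr ?ltr0n //.
  by rewrite ltr_pM2l ?mulr_gt0 //; lra.
(* If [k < l] the angle is negative, and the conjugate root is used instead. *)
have t1 : cis t != 1 :> C.
  move: kl; rewrite neq_ltn => /orP[] lt; last exact: z1.
  apply: contra (z1 _ _ lt) => /eqP e1; rewrite -opprB mulrN mulNr -conj_cis.
  by rewrite e1 rmorph1.
have zn : cis t ^+ n = 1 :> C.
  rewrite -cisX -mulr_natr /t divfK //.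
  rewrite mulrBr cisD -conj_cis !mulr_natr !cis_2piMn rmorph1 mulr1 //.
apply/eqP; have := subrX1 (cis t : C) n; rewrite zn subrr => /esym/eqP.
by rewrite mulf_eq0 subr_eq0 (negPf t1).
Qed.

End Cis.

(** Orthonormality of the columns is the first relation; orthonormality of the rows gives the
    expansion of every vector. *)
Lemma unitary_columns_basis (R : realType) (I : finType) (V : I -> I -> R[i]) :
  (forall k l, \sum_i V i k * (V i l)^* = (k == l)%:R) ->
  (forall i j, \sum_k V i k * (V j k)^* = (i == j)%:R) ->
  @orthonormal_basis R (ell2_hilbert R I) I (fun k => [ffun i => V i k] : ell2 R I).
Proof.
move=> V1 V2; split=> [k l|x].
  by rewrite -V1; apply: eq_bigr => i _; rewrite !ffunE.
apply/ffunP => j; rewrite sum_ffunE.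
transitivity (\sum_k \sum_i x i * (V j k * (V i k)^*)).
  rewrite exchange_big /= (bigD1 j) //= -mulr_sumr V2 eqxx mulr1 big1 ?addr0 //.
  by move=> i ij; rewrite -mulr_sumr V2 eq_sym (negPf ij) mulr0.
apply: eq_bigr => k _; rewrite !ffunE [hdot _ _ _]/(ell2_dot _ _) /ell2_dot.
rewrite [_ *: _]mulr_suml; apply: eq_bigr => i _.
by rewrite ffunE [V j k * _]mulrC; apply: mulrA.
Qed.

(** * The discrete Fourier basis *)

Section FourierBasis.
Context {R : realType} (n : nat).
Local Notation C := (R[i]).
Local Notation I := ('I_n * bool)%type.
Hypothesis n0 : (0 < n)%N.

Definition dft (j k : 'I_n) : C := cis (2 * pi * j%:R * k%:R / n%:R).

(* The Fourier matrix tensored with the identity of [C^2]. *)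
Definition dft2 (i k : I) : C :=
  (i.2 == k.2)%:R * (dft i.1 k.1 / (Num.sqrt (n%:R : R))%:C).

Definition ell2_std (k : I) : ell2_hilbert R I := [ffun i => (i == k)%:R] : ell2 R I.
Definition ell2_dft (k : I) : ell2_hilbert R I := [ffun i => dft2 i k] : ell2 R I.

Let sn : C := (Num.sqrt (n%:R : R))%:C.
Let sn2 : sn * sn = n%:R.
Proof. by rewrite /sn -rmorphM /= -expr2 sqr_sqrtr ?ler0n // rmorph_nat. Qed.
Let conj_sn : sn^* = sn.
Proof. by apply/CrealP/complex_realP; exists (Num.sqrt n%:R). Qed.

Lemma dft_sym j k : dft j k = dft k j.
Proof. by rewrite /dft -mulrA [_ * (k%:R / _)]mulrC -mulrA -[in RHS]mulrA; congr cis; ring. Qed.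

Lemma dft_orth (k l : 'I_n) : \sum_j dft j k * (dft j l)^* = (k == l)%:R * n%:R.
Proof.
rewrite -sum_cis_orth; apply: eq_bigr => j _.
rewrite /dft conj_cis -cisD; congr cis.
have nz : n%:R != 0 :> R by rewrite pnatr_eq0 -lt0n.
by field.
Qed.

Lemma ell2_dft_basis : orthonormal_basis ell2_dft.
Proof.
have key (c d : bool) (k l : 'I_n) :
  \sum_(i : I) ((i.2 == c)%:R * (dft i.1 k / sn)) *
     ((i.2 == d)%:R * (dft i.1 l / sn))^* = ((k, c) == (l, d))%:R.
  rewrite -(pair_bigA _ (fun i e => ((e == c)%:R * (dft i k / sn)) *
     ((e == d)%:R * (dft i l / sn))^*)) /=.
  transitivity (\sum_i (c == d)%:R * (dft i k * (dft i l)^*) / n%:R).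
    apply: eq_bigr => i _; rewrite big_bool.
    have e (x y : C) : (x / sn) * (y / sn)^* = x * y^* / n%:R.
      by rewrite rmorphM fmorphV /= conj_sn mulrACA -invfM sn2.
    case: c; case: d; rewrite /= ?rmorphM ?rmorph0 ?rmorph1 ?mul0r ?mulr0 ?mul1r ?addr0 ?add0r -?rmorphM ?e //.
  rewrite -mulr_suml -mulr_sumr dft_orth xpair_eqE andbC.
  have nz : n%:R != 0 :> C by rewrite pnatr_eq0 -lt0n.
  by rewrite mulrA mulfK // -natrM mulnb.
apply: unitary_columns_basis => -[k c] [l d]; rewrite /dft2 /=.
  exact: key.
(* The matrix is symmetric, so the relations for rows are those for columns. *)
rewrite -key; apply: eq_bigr => -[i e] _ /=.
by rewrite ![e == _]eq_sym ![dft i _]dft_sym.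
Qed.

Lemma ell2_std_basis : orthonormal_basis ell2_std.
Proof.
apply: unitary_columns_basis => k l.
  rewrite (bigD1 k) //= eqxx mul1r big1 ?addr0 ?rmorph_nat // => i /negPf ->.
  by rewrite mul0r.
rewrite (bigD1 k) //= eqxx mul1r big1 ?addr0 ?rmorph_nat 1?eq_sym // => i.
by rewrite eq_sym => /negPf ->; rewrite mul0r.
Qed.

Lemma hdot_ell2_std (x : ell2_hilbert R I) i : hdot _ x (ell2_std i) = x i.
Proof.
rewrite [LHS]/(ell2_dot _ _) /ell2_dot (bigD1 i) //= ffunE eqxx rmorph1.
rewrite mulr1 big1 ?addr0 // => j /negPf ji.
by rewrite ffunE ji rmorph0 mulr0.
Qed.

Lemma hdot_ell2_dft k i : hdot _ (ell2_dft k) (ell2_std i) = dft2 i k.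
Proof. by rewrite hdot_ell2_std ffunE. Qed.

(** Retains only the transition matrix between two orthonormal bases; the construction of the
    operators then proceeds without coordinates. *)
Lemma dft_bases : exists (H : hilbertType R) (f g : I -> H),
  [/\ orthonormal_basis f, orthonormal_basis g &
      forall k i, hdot H (g k) (f i) = dft2 i k].
Proof.
exists (ell2_hilbert R I), ell2_std, ell2_dft; split.
- exact: ell2_std_basis.
- exact: ell2_dft_basis.
- exact: hdot_ell2_dft.
Qed.

End FourierBasis.

(** * The operators of the counterexample *)

Section Witness.
Context {R : realType} (n : nat) (H : hilbertType R).
Local Notation C := (R[i]).
Local Notation I := ('I_n * bool)%type.
Variables f g : I -> H.
Hypotheses (fP : orthonormal_basis f) (gP : orthonormal_basis g).
Hypothesis n0 : (0 < n)%N.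
Hypothesis gf : forall k i, hdot H (g k) (f i) = dft2 i k.

Let flip (k : I) : I := (k.1, ~~ k.2).
(** [al] ignores the second index, so [A] commutes with the flip, while [be] changes by exactly one
    under it. Both take integer values, where [phi] can be prescribed. *)
Let al (k : I) : R := (k.1 : nat)%:R.
Let be (k : I) : R := (k.1.*2 + k.2)%N%:R.
Let A : {linear H -> H} := wperm f id (fun k => (al k)%:C).
Let B : {linear H -> H} := wperm g id (fun k => (be k)%:C).
Let T : {linear H -> H} := wperm f flip (fun=> 1).

Let flipK : involutive flip.
Proof. by case=> j b; rewrite /flip /= negbK. Qed.

Let A_f j : A (f j) = (al j)%:C *: f j.
Proof. exact: (wperm_basis fP). Qed.

Let B_g j : B (g j) = (be j)%:C *: g j.
Proof. exact: (wperm_basis gP). Qed.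

Let T_f i : T (f i) = f (flip i).
Proof. by rewrite -[RHS]scale1r; apply: (wperm_basis fP). Qed.

Let hdot_T x i : hdot H (T x) (f i) = hdot H x (f (flip i)).
Proof.
rewrite [T x]/(wperm _ _ _ _) /wperm hdot_suml (bigD1 (flip i)) //.
rewrite hdotZl fP.1 flipK eqxx mulr1 mul1r big1 => [|j ji]; first exact: addr0.
rewrite hdotZl fP.1 (_ : (_ == _) = false) ?mulr0 //.
by apply: contraNF ji => /eqP <-; rewrite flipK.
Qed.

(** [T] is defined through [f] but acts on the factor [C^2] only, and the transition matrix is the
    identity on that factor. *)
Let T_g k : T (g k) = g (flip k).
Proof.
apply: (basis_eq fP) => i; rewrite hdot_T !gf /dft2 /=.
by case: i.2; case: k.2.
Qed.

(** The zero operator, put in the shape to which [wperm_schatten_le] applies. *)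
Let comm_AT : commutator A T = wperm f flip (fun=> 0).
Proof.
apply/funext => x; rewrite /commutator.
have -> : A (T x) = T (A x).
  apply: (@linear_basis_eq _ _ _ _ fP (A \o T) (T \o A)) => i.
  change (A (T (f i)) = T (A (f i))).
  by rewrite T_f !A_f linearZ; congr (_ *: _); rewrite T_f.
by rewrite subrr /wperm big1 // => i _; rewrite mul0r scale0r.
Qed.

(** The coefficient is the eigenvalue difference [be (flip k) - be k], which is 1 on even and -1 on
    odd eigenvalues. *)
Let comm_BT : commutator B T = wperm g flip (fun k => (-1) ^+ k.2).
Proof.
apply/funext => x; rewrite /commutator; apply/eqP; rewrite subr_eq addrC; apply/eqP.
pose W : {linear H -> H} := wperm g flip (fun k => (-1) ^+ k.2).
have Wg k : W (g k) = (-1) ^+ k.2 *: g (flip k) by apply: (wperm_basis gP).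
apply: (@linear_basis_eq _ _ _ _ gP (B \o T) ((T \o B) \+ W)) => k.
change (B (T (g k)) = T (B (g k)) + W (g k)).
rewrite T_g !B_g linearZ T_g Wg -scalerDl; congr (_ *: _).
case: k => k [] /=; rewrite /be /= !natrD !rmorphD /=.
  by rewrite rmorph0 addr0 expr1 addrK.
by rewrite addr0 rmorph1 expr0.
Qed.

Let wperm_opnorm_le1 h c : orthonormal_basis h ->
  (forall i : I, `|c i| <= 1) -> (opnorm (wperm h flip c : H -> H) <= 1)%E.
Proof.
move=> hP c1; apply: ge_ereal_sup => _ [x /= x1 <-].
have := @wperm_le _ _ _ _ hP flip c 1 x (can_inj flipK) ler01 c1.
rewrite mul1r => /le_trans/(_ x1); rewrite lee_fin.
by case: `|_| => u v; rewrite lecE => /andP[].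
Qed.

Let wperm_schatten_le (p : R) h c : 0 < p -> orthonormal_basis h ->
  (forall i : I, `|c i| <= 1) ->
  (schatten_norm p (wperm h flip c : H -> H) <= ((n * 2)%N%:R `^ p^-1)%:E)%E.
Proof.
move=> p0 hP c1; apply: schatten_le_rank => //.
- by apply: (wperm_bounded hP); apply: can_inj flipK.
- by have := wperm_rank_le h flip c; rewrite card_prod card_ord card_bool.
- exact: wperm_opnorm_le1.
Qed.

Variable phi : R * R -> C.
Hypothesis phi_even : forall j k : 'I_n,
  phi (j%:R, (k.*2)%:R) = (dft j k)^*.
Hypothesis phi_odd : forall j k : 'I_n, phi (j%:R, (k.*2.+1)%:R) = 0.

Let sn : C := (Num.sqrt (n%:R : R))%:C.
Let sn2 : sn * sn = n%:R.
Proof. by rewrite /sn -rmorphM /= -expr2 sqr_sqrtr ?ler0n // rmorph_nat. Qed.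

Let fcalcE x : fcalc phi A B x =
  \sum_i (\sum_j phi (al i, be j) * (hdot H x (g j) * dft2 i j)) *: f i.
Proof.
rewrite (fcalc_basis_diag phi al be x fP gP); apply: eq_bigr => i _.
by rewrite scaler_suml; apply: eq_bigr => j _; rewrite gf.
Qed.

(** The unit vector spread evenly over the [n] eigenvectors of [B] with even eigenvalue. *)
Let x0 : H := \sum_(k : I | ~~ k.2) sn^-1 *: g k.

Let hdot_x0 k : hdot H x0 (g k) = if k.2 then 0 else sn^-1.
Proof. by rewrite (hdot_basis_sum gP) if_neg. Qed.

Let hdot_Tx0 k : hdot H (T x0) (g k) = if k.2 then sn^-1 else 0.
Proof.
rewrite /x0 linear_sum (eq_bigr (fun k => sn^-1 *: g (flip k))); last first.
  by move=> i _; rewrite linearZ T_g.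
rewrite (reindex_inj (can_inj flipK)) /= (eq_bigr (fun k => sn^-1 *: g k)).
  by rewrite (hdot_basis_sum gP) /= negbK.
by move=> i _; rewrite flipK.
Qed.

(** The prescribed values of [phi] cancel the phases of the Fourier matrix, so each of the [n] terms
    in a coordinate equals [1/n] and no cancellation remains. *)
Let fcalc_x0 : fcalc phi A B x0 = \sum_(i : I | ~~ i.2) 1 *: f i.
Proof.
rewrite fcalcE [RHS]big_mkcond /=; apply: eq_bigr => -[i e] _ /=.
have nz : (n%:R : C) != 0 by rewrite pnatr_eq0 -lt0n.
rewrite (eq_bigr (fun p : I => phi (al (i, e), be (p.1, p.2)) *
   (hdot H x0 (g (p.1, p.2)) * dft2 (i, e) (p.1, p.2)))) => [|[] //].
rewrite -(pair_bigA _ (fun k b => phi (al (i, e), be (k, b)) *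
   (hdot H x0 (g (k, b)) * dft2 (i, e) (k, b)))) /=.
rewrite (eq_bigr (fun=> (~~ e)%:R / n%:R)) => [|k _].
  rewrite sumr_const card_ord -[_ *+ n]mulr_natr divfK //.
  by case: e; rewrite ?scale0r.
rewrite big_bool /= !hdot_x0 /= mul0r mulr0 add0r /al /be /= addn0 phi_even.
rewrite /dft2 /=; case: e; rewrite /= ?mul0r ?mulr0 ?mul0r // !mul1r.
rewrite [sn^-1 * _]mulrCA -invfM sn2 mulrA [_^* * _]mulrC -normCK normr_cis.
by rewrite expr1n mul1r.
Qed.

(** The flip moves [x0] to the odd eigenvalues of [B], where [phi] vanishes. *)
Let fcalc_Tx0 : fcalc phi A B (T x0) = 0.
Proof.
rewrite fcalcE big1 // => i _; rewrite big1 ?scale0r // => -[k b] _.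
rewrite hdot_Tx0 /=; case: b; last by rewrite mul0r mulr0.
by rewrite /al /be /= addn1 phi_odd mul0r.
Qed.

Let snV : `|sn^-1| ^+ 2 = n%:R^-1 :> C.
Proof.
by rewrite normfV exprVn ger0_norm ?expr2 ?sn2 // lecR sqrtr_ge0.
Qed.

Let x0_norm : `|x0| = 1.
Proof.
apply/eqP; rewrite -(@eqrXn2 _ 2) // expr1n (parseval gP).
have nz : (n%:R : C) != 0 by rewrite pnatr_eq0 -lt0n.
rewrite (eq_bigr (fun k : I => if k.2 then 0 else n%:R^-1)); last first.
  by move=> k _; rewrite hdot_x0; case: k.2; rewrite ?normr0 ?expr0n // snV.
rewrite -(pair_bigA _ (fun k (b : bool) => if b then 0 else n%:R^-1)) /=.
rewrite (eq_bigr (fun=> n%:R^-1)); last by move=> k _; rewrite big_bool /= add0r.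
by rewrite sumr_const card_ord -[_ *+ n]mulr_natr mulVf.
Qed.

Let comm_x0_norm : `|commutator (fcalc phi A B) T x0| = sn.
Proof.
have snge : 0 <= sn by rewrite lecR sqrtr_ge0.
apply/eqP; rewrite -(@eqrXn2 _ 2) //; apply/eqP.
rewrite [sn ^+ 2]expr2 sn2 /commutator fcalc_Tx0 sub0r normrN (parseval fP).
rewrite fcalc_x0 (eq_bigr (fun k : I => if k.2 then 1 else 0)) => [|k _].
  rewrite -(pair_bigA _ (fun k (b : bool) => if b then 1 else 0)) /=.
  rewrite (eq_bigr (fun=> 1)); last by move=> k _; rewrite big_bool /= addr0.
  by rewrite sumr_const card_ord.
rewrite hdot_T (hdot_basis_sum fP) /= negbK.
by case: k.2; rewrite ?normr1 ?normr0 ?expr1n ?expr0n.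
Qed.

Lemma commutator_witness (p : R) : 0 < p ->
  exists A B T : {linear H -> H},
   [/\ bounded_op T,
       [/\ bounded_op A, self_adjoint A & finite_rank A],
       [/\ bounded_op B, self_adjoint B & finite_rank B],
       (maxe (schatten_norm p (commutator A T)) (schatten_norm p (commutator B T))
         <= ((n * 2)%N%:R `^ p^-1)%:E)%E
     & ((Num.sqrt (n%:R : R))%:E <=
          schatten_norm p (commutator (fcalc phi A B) T))%E].
Proof.
move=> p0; exists A, B, T; split.
- by apply: (wperm_bounded fP); apply: can_inj flipK.
- split; first by apply: (wperm_bounded fP).
    exact: (basis_diag_self_adjoint fP).
  by eexists; apply: wperm_rank_le.
- split; first by apply: (wperm_bounded gP).
    exact: (basis_diag_self_adjoint gP).
  by eexists; apply: wperm_rank_le.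
- rewrite ge_max comm_AT comm_BT !wperm_schatten_le // => i.
    by rewrite normrX normrN1 expr1n.
  by rewrite normr0.
- apply: le_trans (opnorm_le_schatten _ _) => //.
    by have := opnorm_ge (commutator (fcalc phi A B) T) (x := x0);
       rewrite x0_norm comm_x0_norm; apply.
  by rewrite /commutator linear0 fcalcE big1 ?linear0 ?subrr ?addr0 // => i _;
     rewrite big1 ?scale0r // => j _; rewrite hdot0l mul0r mulr0.
Qed.

End Witness.

(** * Integration over the plane *)

Section PlaneMeasure.
Context {R : realType}.
Implicit Types (f g : R * R -> R) (x c : R * R).

Lemma measurable_box (a b : R) (e : R) :
  measurable (ball a e `*` ball b e : set (R * R)).
Proof. by apply: measurableX; rewrite ball_itv; apply: measurable_itv. Qed.

(** An open set is a countable union of boxes with rational centres and radii [1/(n+1)], and boxes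
    belong to the product sigma-algebra. *)
Lemma open_measurable2 (U : set (R * R)) : open U -> measurable U.
Proof.
move=> oU.
pose box (p : rat * rat * nat) : set (R * R) :=
  ball (ratr p.1.1 : R) p.2.+1%:R^-1 `*` ball (ratr p.1.2 : R) p.2.+1%:R^-1.
have -> : U = \bigcup_p (if `[< box p `<=` U >] then box p else set0).
  apply/seteqP; split=> [[a b] Uab|x [p _]]; last first.
    by case: asboolP => // h /h.
  have /nbhs_ballP[e /= e0 eU] := open_nbhs_nbhs (conj oU Uab).
  (* A box of this radius that contains the point has diameter less than [e], hence stays in the
     [e]-ball about the point. *)
  have [n ne] : exists n : nat, n.+1%:R^-1 < e / 2.
    exists (Num.bound (2 / e)); have e2 : 0 < 2 / e by rewrite divr_gt0.
    rewrite -(invf_div 2 e) ltf_pV2 ?posrE ?ltr0n //.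
    apply: lt_trans (archi_boundP (ltW e2)) _; rewrite ltr_nat //.
  have n0 : 0 < n.+1%:R^-1 :> R by [].
  have rat_near (t : R) : exists q : rat, ball (ratr q : R) n.+1%:R^-1 t.
    have [q] := @rat_in_itvoo R t (t + n.+1%:R^-1) (ltr_pwDr n0 (lexx t)).
    rewrite in_itv /= => /andP[q1 q2]; exists q.
    by rewrite /ball /= gtr0_norm ?subr_gt0 // ltrBlDl.
  have [q qa] := rat_near a; have [r rb] := rat_near b.
  exists (q, r, n) => //; case: asboolP => [//|]; case.
  have tri (u v w m : R) : m < e / 2 -> `|v - u| < m -> `|v - w| < m -> `|u - w| < e.
    move=> me h1 h2; have -> : u - w = (v - w) - (v - u) by ring.
    apply: le_lt_trans (ler_normB _ _) _; rewrite (splitr e) ltrD //.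
      exact: lt_trans h2 me.
    exact: lt_trans h1 me.
  by move=> [s t] [/= sq tr]; apply: eU; split => /=;
     [apply: tri ne qa sq|apply: tri ne rb tr].
apply: countable_bigcupT_measurable => // p.
by case: asboolP => // _; apply: measurable_box.
Qed.

Lemma continuous_measurable2 f : continuous f -> measurable_fun setT f.
Proof.
move=> /continuousP cf; apply: (measurability _ (measurable_realfun.RGenOpens.measurableE R)).
move=> _ [_ [a [b ->] <-]]; rewrite setTI; apply: open_measurable2.
exact/cf/interval_open.
Qed.

Lemma oneDsqr_gt0 (t : R) : 0 < oneDsqr t.
Proof. exact: lt_le_trans ltr01 (oneDsqr_ge1 t). Qed.

(** The integrable majorant for all estimates below. Its product form reduces its own integral, and
    integration along one variable, to the arctangent integral on the line. *)
Definition decay (x : R * R) : R := (oneDsqr x.1)^-1 * (oneDsqr x.2)^-1.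

Lemma decay_gt0 x : 0 < decay x.
Proof. by rewrite mulr_gt0 // invr_gt0 oneDsqr_gt0. Qed.

Lemma continuous_decay : continuous decay.
Proof.
move=> x; apply: cvgM.
  apply: (@continuous_comp (R * R)%type R R fst (fun t => (oneDsqr t)^-1) x).
    exact: cvg_fst.
  exact: continuous_oneDsqrV.
apply: (@continuous_comp (R * R)%type R R snd (fun t => (oneDsqr t)^-1) x).
  exact: cvg_snd.
exact: continuous_oneDsqrV.
Qed.

Lemma integral_oneDsqrV :
  (\int[@lebesgue_measure R]_t ((oneDsqr t)^-1)%:E = pi%:E)%E.
Proof.
rewrite (ge0_symfun_integralT (f := fun t => (oneDsqr t)^-1)).
- rewrite -set_itvcy integral0y_oneDsqr -EFinM; congr EFin.
  by rewrite mulrCA divff ?mulr1.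
- by move=> t; rewrite invr_ge0 ltW // oneDsqr_gt0.
- exact: continuous_oneDsqrV.
- by move=> t /=; rewrite /oneDsqr sqrrN.
Qed.

Lemma integrable_decay : mu2.-integrable setT (EFin \o decay).
Proof.
have md : measurable_fun setT (EFin \o decay).
  apply/measurable_EFinP. exact: (continuous_measurable2 continuous_decay).
apply/integrable12ltyP => //.
have sq0 (t : R) : 0 <= (oneDsqr t)^-1 by rewrite invr_ge0 ltW // oneDsqr_gt0.
have mq : measurable_fun setT (fun t : R => (oneDsqr t)^-1).
  by apply: continuous_measurable_fun; apply: continuous_oneDsqrV.
have mqE : measurable_fun setT (fun t : measurableTypeR R => ((oneDsqr t)^-1)%:E).
  exact/measurable_EFinP.
have q0E (t : measurableTypeR R) : setT t -> (0 <= ((oneDsqr t)^-1)%:E)%E by rewrite lee_fin.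
have inner (s : R) : (\int[@lebesgue_measure R]_t `|(EFin \o decay) (s, t)| =
    pi%:E * ((oneDsqr s)^-1)%:E)%E.
  transitivity (\int[@lebesgue_measure R]_t
     (((oneDsqr s)^-1)%:E * ((oneDsqr t)^-1)%:E))%E.
    apply: eq_integral => t _.
    by rewrite /= ger0_norm ?(ltW (decay_gt0 _)) // -EFinM.
  rewrite muleC -integral_oneDsqrV.
  by rewrite ge0_integralZl_EFin.
under eq_integral => s _ do rewrite inner.
apply: (@le_lt_trans _ _ (pi%:E * pi%:E)%E); last by rewrite -EFinM ltry.
rewrite -[X in (_ * X)%E]integral_oneDsqrV le_eqVlt; apply/orP; left; apply/eqP.
by rewrite ge0_integralZl_EFin //; apply: pi_ge0.
Qed.

Local Notation RT := (measurableTypeR R).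

Definition reflection1 (a : R) : RT -> RT := fun t => a - t.

Lemma measurable_reflection1 (a : R) : measurable_fun setT (reflection1 a).
Proof.
by apply: continuous_measurable_fun => t; apply: cvgB; [exact: cvg_cst|exact: cvg_id].
Qed.

HB.instance Definition _ a :=
  isMeasurableFun.Build _ _ _ _ (reflection1 a) (measurable_reflection1 a).

(** Lebesgue measure is determined by its values on half-open intervals; reflection exchanges the
    open and the closed end and preserves the length. *)
Lemma lebesgue_reflection (a : R) (A : set RT) : measurable A ->
  lebesgue_measure (reflection1 a @^-1` A) = lebesgue_measure A.
Proof.
move=> mA.
pose m' : {measure set RT -> \bar R} :=
  pushforward (@lebesgue_measure R) (reflection1 a).
rewrite [RHS](@lebesgue_measure_unique _ (m' (measurable_reflection1 a))) // => X [[u v] _ <-] /=.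
rewrite /pushforward.
have -> : reflection1 a @^-1` `]u, v]%classic = `[a - v, a - u[%classic.
  apply/seteqP; split => t /=; rewrite !in_itv /= /reflection1; lra.
rewrite !lebesgue_measure_itv /= !lte_fin ltrD2l ltrN2.
by case: ifP => // _; rewrite -!EFinB; congr EFin; lra.
Qed.

Definition reflection c : (RT * RT)%type -> (RT * RT)%type := fun y => c - y.

Lemma measurable_reflection c : measurable_fun setT (reflection c).
Proof.
apply: measurable_fun_pair => /=.
  exact: (measurableT_comp (measurable_reflection1 c.1) measurable_fst).
exact: (measurableT_comp (measurable_reflection1 c.2) measurable_snd).
Qed.

HB.instance Definition _ c :=
  isMeasurableFun.Build _ _ _ _ (reflection c) (measurable_reflection c).

(** By uniqueness of the product measure it suffices to compare rectangles, which reflect factor by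
    factor. *)
Lemma mu2_reflection c X : measurable X -> mu2 X = pushforward mu2 (reflection c) X.
Proof.
move=> mX; apply: (product_measure_unique (m' := pushforward mu2 (reflection c))) => //.
move=> A B mA mB; rewrite /pushforward.
have mA' : measurable (reflection1 c.1 @^-1` A).
  by rewrite -[X in measurable X]setTI; apply: measurable_reflection1.
have mB' : measurable (reflection1 c.2 @^-1` B).
  by rewrite -[X in measurable X]setTI; apply: measurable_reflection1.
transitivity (lebesgue_measure A * lebesgue_measure B)%E => //.
rewrite -(lebesgue_reflection c.1 mA) -(lebesgue_reflection c.2 mB).
exact: (product_measure1E lebesgue_measure lebesgue_measure mA' mB').
Qed.

Lemma integrable_le_decay f (M : R) : continuous f ->
  (forall x, `|f x| <= M * decay x) -> mu2.-integrable setT (EFin \o f).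
Proof.
move=> cf fM; apply: (@le_integrable _ _ _ mu2 setT _ _ (EFin \o (fun x => M * decay x))) => //.
- by apply/measurable_EFinP; apply: continuous_measurable2.
- move=> x _ /=; rewrite lee_fin; apply: le_trans (fM x) _; exact: ler_norm.
- have := integrableZl measurableT M integrable_decay.
  by apply: eq_integrable => // x _ /=; rewrite EFinM.
Qed.

Lemma Rintegral_reflection f c (M : R) : continuous f ->
  (forall x, `|f x| <= M * decay x) ->
  (\int[mu2]_y f (c - y) = \int[mu2]_y f y)%R.
Proof.
move=> cf fM; have fi := integrable_le_decay cf fM.
have mf : measurable_fun setT (EFin \o f) by apply/measurable_EFinP; apply: continuous_measurable2.
have eqm : forall g : R * R -> \bar R, (\int[mu2]_y g y = \int[pushforward mu2 (reflection c)]_y g y)%E.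
  by move=> g; apply: eq_measure_integral => A mA _; apply: mu2_reflection.
rewrite /Rintegral [in RHS]eqm.
rewrite (integral_pushforward (phi := reflection c)) //.
apply/integrableP; split.
  exact: (measurableT_comp mf (measurable_reflection c)).
have /integrableP[_] := fi; rewrite eqm ge0_integral_pushforward //.
exact: measurableT_comp.
Qed.

End PlaneMeasure.

(** * Integrals of derivatives vanish *)

Section IntegralDerivative.
Context {R : realType}.
Local Notation mu := (@lebesgue_measure R).

Lemma invr_oneDsqr_ge0 (t : R) : 0 <= (oneDsqr t)^-1.
Proof. by rewrite invr_ge0 ltW // oneDsqr_gt0. Qed.

Lemma integrable_oneDsqrV (M : R) :
  mu.-integrable setT (fun t => (M * (oneDsqr t)^-1)%:E).
Proof.
have mq : measurable_fun setT (fun t : measurableTypeR R => (oneDsqr t)^-1).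
  by apply: continuous_measurable_fun; apply: continuous_oneDsqrV.
have iq : mu.-integrable setT (fun t => ((oneDsqr t)^-1)%:E).
  apply/integrableP; split; first exact/measurable_EFinP.
  under eq_integral => t _ do rewrite /= ger0_norm ?invr_oneDsqr_ge0 //.
  by rewrite integral_oneDsqrV ltry.
have := integrableZl measurableT M iq.
by apply: eq_integrable => // t _ /=; rewrite EFinM.
Qed.

(** The fundamental theorem of calculus on [[-n, n]]: the truncated integrals converge by
    domination, and the boundary terms tend to 0. *)
Lemma integral_derive0 (G g : R -> R) (M : R) :
  (forall t, is_derive t (1 : R) G (g t)) -> continuous g ->
  (forall t, `|G t| <= M * (oneDsqr t)^-1) ->
  (forall t, `|g t| <= M * (oneDsqr t)^-1) ->
  (\int[mu]_t (g t)%:E = 0)%E.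
Proof.
move=> dG cg GM gM.
have cG : continuous G by move=> t; apply/differentiable_continuous/derivable1_diffP.
have mg : measurable_fun setT (fun t : measurableTypeR R => (g t)%:E).
  by apply/measurable_EFinP; apply: continuous_measurable_fun.
pose I_ (n : nat) : set (measurableTypeR R) := `[- n%:R, n%:R]%classic.
pose g_ (n : nat) : measurableTypeR R -> \bar R := (fun t => (g t)%:E) \_ (I_ n).
have mI n : measurable (I_ n) by apply: measurable_itv.
have lim_g : (\int[mu]_t g_ n t)%E @[n --> \oo] --> (\int[mu]_t (g t)%:E)%E.
  have [] := @dominated_convergence _ _ _ mu setT measurableT g_
     (fun t => (g t)%:E) (fun t => (M * (oneDsqr t)^-1)%:E).
  - by move=> n; apply/(measurable_restrictT _ (mI n)); apply: measurable_funTS.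
  - exact: mg.
  - apply: aeW => t _; apply: cvg_near_cst; near=> n.
    rewrite /g_ patchE mem_set // /I_ /= in_itv /= -ler_norml.
    by near: n; apply: nbhs_infty_ger.
  - exact: integrable_oneDsqrV.
  - apply: aeW => t n _; rewrite /g_ patchE; case: ifP => _ /=.
      by rewrite lee_fin.
    by rewrite normr0 lee_fin; apply: le_trans (gM t).
  - by move=> _ _; apply.
(* The index starts at 1 because the interval has to be nondegenerate. *)
have int_g n : (\int[mu]_t g_ n.+1 t = (G n.+1%:R - G (- n.+1%:R))%:E)%E.
  rewrite -integral_mkcond EFinB; apply: continuous_FTC2.
  - by rewrite -subr_gt0 opprK addr_gt0.
  - exact: continuous_subspaceT.
  - split; first by move=> x _; have [] := dG x.
      by apply: cvg_at_right_filter; apply: cG.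
    by apply: cvg_at_left_filter; apply: cG.
  - by move=> x _; rewrite derive1E derive_val.
have M0 : 0 <= M.
  have := le_trans (normr_ge0 _) (GM 0).
  by rewrite /oneDsqr expr0n addr0 invr1 mulr1.
have tail n : `|G n.+1%:R - G (- n.+1%:R)| <= 2 * M * harmonic n.
  have nn : 1 <= n.+1%:R :> R by rewrite ler1n.
  have hn : (oneDsqr (n.+1%:R : R))^-1 <= harmonic n.
    rewrite /harmonic /= lef_pV2 ?posrE ?oneDsqr_gt0 // /oneDsqr; nra.
  apply: le_trans (ler_normB _ _) _; rewrite mulr_natl mulrDl; apply: lerD.
    by apply: le_trans (GM _) _; rewrite ler_wpM2l.
  by apply: le_trans (GM _) _; rewrite ler_wpM2l // /oneDsqr sqrrN.
have lim0 : (\int[mu]_t g_ n.+1 t)%E @[n --> \oo] --> 0%E.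
  rewrite (eq_cvg _ _ int_g); apply: cvg_EFin; first by near=> n.
  have h0 : (2 * M * harmonic n) @[n --> \oo] --> (0 : R).
    by rewrite -[X in _ --> X](mulr0 (2 * M)); apply: cvgMr; apply: cvg_harmonic.
  apply/norm_cvg0P.
  apply: (squeeze_cvgr _ (cvg_cst 0) h0).
  by near=> n; rewrite normr_ge0 tail.
rewrite -(cvg_shiftS (fun n => \int[mu]_t g_ n t)%E) in lim_g.
exact: (cvg_unique _ lim_g lim0).
Unshelve. all: by end_near. Qed.

End IntegralDerivative.

Section PlaneDerivative.
Context {R : realType}.

Lemma slice_derive (f : R * R -> R) (d : bool) (s t : R) :
  differentiable f (if d then (s, t) else (t, s)) ->
  is_derive t (1 : R) (fun t => f (if d then (s, t) else (t, s)))
    ('D_(dir d) f (if d then (s, t) else (t, s))).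
Proof.
move=> df.
have e : (fun h : R => h^-1 *: (((fun t => f (if d then (s, t) else (t, s))) \o shift t) (h *: (1 : R)) -
             f (if d then (s, t) else (t, s)))) =
         (fun h : R => h^-1 *: ((f \o shift (if d then (s, t) else (t, s))) (h *: dir d) -
             f (if d then (s, t) else (t, s)))).
  apply/funext => h /=; congr (_ *: (f _ - _)).
  by case: d {df}; rewrite /dir; congr pair; rewrite /= ?scaler0 ?add0r.
have dv : derivable f (if d then (s, t) else (t, s)) (dir d).
  exact: diff_derivable.
by apply: DeriveDef; rewrite /derivable /derive e.
Qed.

Lemma Rintegral_derive_dir0 (f : R * R -> R) (d : bool) (M : R) :
  (forall x, differentiable f x) -> continuous ('D_(dir d) f) ->
  (forall x, `|f x| <= M * decay x) ->
  (forall x, `|'D_(dir d) f x| <= M * decay x) ->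
  (\int[mu2]_x 'D_(dir d) f x = 0)%R.
Proof.
move=> df cDf fM DfM.
have iDf := integrable_le_decay cDf DfM.
have slice0 (s : R) : (\int[@lebesgue_measure R]_t
    ('D_(dir d) f (if d then (s, t) else (t, s)))%:E = 0)%E.
  apply: (@integral_derive0 _ (fun t => f (if d then (s, t) else (t, s))) _
            (M * (oneDsqr s)^-1)).
  - by move=> t; apply: slice_derive.
  - move=> t; apply: (@continuous_comp R (R * R)%type R
      (fun t => if d then (s, t) else (t, s)) ('D_(dir d) f) t); last exact: cDf.
    case: (d).
      by apply: (@cvg_pair R R R (nbhs t) (nbhs s) (nbhs t) _ _ _ (fun=> s) id);
        [exact: cvg_cst|exact: cvg_id].
    by apply: (@cvg_pair R R R (nbhs t) (nbhs t) (nbhs s) _ _ _ id (fun=> s));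
      [exact: cvg_id|exact: cvg_cst].
  - move=> u; apply: le_trans (fM _) _; rewrite /decay -mulrA.
    by case: (d) => //=; rewrite [(oneDsqr u)^-1 * _]mulrC.
  - move=> u; apply: le_trans (DfM _) _; rewrite /decay -mulrA.
    by case: (d) => //=; rewrite [(oneDsqr u)^-1 * _]mulrC.
(* Fubini, in the order that integrates along the direction [d] first. *)
rewrite /Rintegral; case: d {df cDf fM DfM} iDf slice0 => iDf slice0.
  rewrite -(integral12_prod_meas1 iDf) /fubini_F integral0_eq // => s _.
  exact: slice0.
rewrite -(integral21_prod_meas1 iDf) /fubini_G integral0_eq // => s _.
exact: slice0.
Qed.

End PlaneDerivative.

(** * Integrals of complex-valued functions *)

Section ComplexIntegral.
Context {R : realType}.
Local Notation C := (R[i]).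
Implicit Types (f g psi : R * R -> C) (x y : R * R) (z : C).

Lemma cmodE z : cmod z = Num.sqrt (complex.Re z ^+ 2 + complex.Im z ^+ 2).
Proof. by rewrite /cmod normc_def. Qed.

Lemma cmod_ge0 z : 0 <= cmod z.
Proof. by rewrite cmodE sqrtr_ge0. Qed.

Lemma cmod0 : cmod (0 : C) = 0.
Proof. by rewrite cmodE /= expr0n addr0 sqrtr0. Qed.

Lemma cmodM z1 z2 : cmod (z1 * z2) = cmod z1 * cmod z2.
Proof.
by apply: (@complexI R); rewrite rmorphM /= -!normc_real normrM.
Qed.

Lemma cmodD z1 z2 : cmod (z1 + z2) <= cmod z1 + cmod z2.
Proof. by rewrite -lecR rmorphD /= -!normc_real ler_normD. Qed.

Lemma cmod_sum (J : Type) (r : seq J) (P : pred J) (F : J -> C) :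
  cmod (\sum_(j <- r | P j) F j) <= \sum_(j <- r | P j) cmod (F j).
Proof.
apply: (big_ind2 (fun a b => cmod a <= b)) => [|a b c d ab cd|//].
  by rewrite cmod0.
exact: le_trans (cmodD _ _) (lerD ab cd).
Qed.

Lemma cmod_real (r : R) : 0 <= r -> cmod r%:C = r.
Proof. by move=> r0; rewrite cmodE /= expr0n addr0 sqrtr_sqr ger0_norm. Qed.

Lemma Re_le_cmod z : `|complex.Re z| <= cmod z.
Proof. by rewrite -lecR -normc_real Re_le_normc. Qed.

Lemma Im_le_cmod z : `|complex.Im z| <= cmod z.
Proof. by rewrite -lecR -normc_real Im_le_normc. Qed.

Lemma cmod_le_Re_Im z : cmod z <= `|complex.Re z| + `|complex.Im z|.
Proof. by rewrite -lecR -normc_real normc_le_Re_Im. Qed.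

Definition ccontinuous f := continuous (reF f) /\ continuous (imF f).

Lemma cdifferentiable_ccontinuous f : cdifferentiable f -> ccontinuous f.
Proof.
by move=> df; split=> x; have [d1 d2] := df x; apply: differentiable_continuous.
Qed.

Lemma ccontinuous_cst z : ccontinuous (fun=> z).
Proof. by split=> x; apply: cvg_cst. Qed.

Lemma ccontinuousD f g : ccontinuous f -> ccontinuous g ->
  ccontinuous (fun x => f x + g x).
Proof.
move=> [f1 f2] [g1 g2]; split=> x.
  rewrite (_ : reF _ = (fun x => reF f x + reF g x)); first exact: (cvgD (f1 x) (g1 x)).
  by apply/funext => y; rewrite /reF raddfD.
rewrite (_ : imF _ = (fun x => imF f x + imF g x)); first exact: (cvgD (f2 x) (g2 x)).
by apply/funext => y; rewrite /imF raddfD.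
Qed.

Lemma ccontinuousM f g : ccontinuous f -> ccontinuous g ->
  ccontinuous (fun x => f x * g x).
Proof.
move=> [f1 f2] [g1 g2]; split=> x.
  rewrite (_ : reF _ = (fun x => reF f x * reF g x - imF f x * imF g x)).
    exact: (cvgB (cvgM (f1 x) (g1 x)) (cvgM (f2 x) (g2 x))).
  by apply/funext => y; rewrite /reF /imF; case: (f y) (g y) => a b [].
rewrite (_ : imF _ = (fun x => reF f x * imF g x + imF f x * reF g x)).
  exact: (cvgD (cvgM (f1 x) (g2 x)) (cvgM (f2 x) (g1 x))).
by apply/funext => y; rewrite /reF /imF; case: (f y) (g y) => a b [].
Qed.

(* All integrals below are of tame functions; Schwartz functions are tame. *)
Definition tame f := ccontinuous f /\ exists M : R, forall x, cmod (f x) <= M * decay x.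

Definition bdd_continuous f := ccontinuous f /\ exists M : R, forall x, cmod (f x) <= M.

Lemma bound_ge0 f (M : R) : (forall x, cmod (f x) <= M * decay x) -> 0 <= M.
Proof.
move=> fM; have := le_trans (cmod_ge0 _) (fM 0).
by rewrite pmulr_lge0 // decay_gt0.
Qed.

Lemma tameM f g : bdd_continuous f -> tame g -> tame (fun x => f x * g x).
Proof.
move=> [cf [M fM]] [cg [M' gM]]; split; first exact: ccontinuousM.
exists (M * M') => x; rewrite cmodM -mulrA ler_pM ?cmod_ge0 //.
Qed.

Lemma bdd_continuousM f g : bdd_continuous f -> bdd_continuous g ->
  bdd_continuous (fun x => f x * g x).
Proof.
move=> [cf [M fM]] [cg [M' gM]]; split; first exact: ccontinuousM.
exists (M * M') => x; rewrite cmodM ler_pM ?cmod_ge0 //.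
Qed.

Lemma bdd_continuousD f g : bdd_continuous f -> bdd_continuous g ->
  bdd_continuous (fun x => f x + g x).
Proof.
move=> [cf [M fM]] [cg [M' gM]]; split; first exact: ccontinuousD.
exists (M + M') => x; apply: le_trans (cmodD _ _) (lerD _ _) => //.
Qed.

Lemma bdd_continuous_cst z : bdd_continuous (fun=> z).
Proof. by split; [exact: ccontinuous_cst|exists (cmod z)]. Qed.

Lemma tameZ z g : tame g -> tame (fun x => z * g x).
Proof. by apply: tameM; apply: bdd_continuous_cst. Qed.

Lemma tameD f g : tame f -> tame g -> tame (fun x => f x + g x).
Proof.
move=> [cf [M fM]] [cg [M' gM]]; split; first exact: ccontinuousD.
exists (M + M') => x; rewrite mulrDl; exact: le_trans (cmodD _ _) (lerD _ _).
Qed.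

Lemma tame0 : tame (fun=> 0 : C).
Proof.
split; first exact: ccontinuous_cst.
by exists 0 => x; rewrite cmod0 mul0r.
Qed.

Lemma tame_sum (J : Type) (r : seq J) (F : J -> R * R -> C) :
  (forall j, tame (F j)) -> tame (fun x => \sum_(j <- r) F j x).
Proof.
move=> tF; elim: r => [|j r IH].
  by rewrite (_ : (fun=> _) = fun=> 0); [exact: tame0|apply/funext => x; rewrite big_nil].
rewrite (_ : (fun=> _) = fun x => F j x + \sum_(j <- r) F j x); first exact: tameD.
by apply/funext => x; rewrite big_cons.
Qed.

Lemma bdd_continuous_sum (J : Type) (r : seq J) (F : J -> R * R -> C) :
  (forall j, bdd_continuous (F j)) ->
  bdd_continuous (fun x => \sum_(j <- r) F j x).
Proof.
move=> tF; elim: r => [|j r IH].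
  rewrite (_ : (fun=> _) = fun=> 0); first exact: bdd_continuous_cst.
  by apply/funext => x; rewrite big_nil.
rewrite (_ : (fun=> _) = fun x => F j x + \sum_(j <- r) F j x).
  exact: bdd_continuousD.
by apply/funext => x; rewrite big_cons.
Qed.

Lemma tame_integrable_Re f : tame f -> mu2.-integrable setT (EFin \o reF f).
Proof.
move=> [[c1 _] [M fM]]; apply: (@integrable_le_decay _ _ M) => // x.
exact: le_trans (Re_le_cmod _) (fM x).
Qed.

Lemma tame_integrable_Im f : tame f -> mu2.-integrable setT (EFin \o imF f).
Proof.
move=> [[_ c2] [M fM]]; apply: (@integrable_le_decay _ _ M) => // x.
exact: le_trans (Im_le_cmod _) (fM x).
Qed.

Lemma tame_cintegrable f : tame f -> cintegrable f.
Proof. by move=> tf; split; [exact: tame_integrable_Re|exact: tame_integrable_Im]. Qed.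

Lemma cint0 : cint (fun=> 0 : C) = 0.
Proof. by rewrite /cint /reF /imF /= /Rintegral integral0. Qed.

Lemma cintD f g : tame f -> tame g -> cint (fun x => f x + g x) = cint f + cint g.
Proof.
move=> tf tg; rewrite /cint; apply/eqP; rewrite eq_complex /=; apply/andP; split.
  rewrite -RintegralD ?tame_integrable_Re //; apply/eqP.
  by apply: eq_Rintegral => x _; rewrite /reF raddfD.
rewrite -RintegralD ?tame_integrable_Im //; apply/eqP.
by apply: eq_Rintegral => x _; rewrite /imF raddfD.
Qed.

Lemma cintZ z f : tame f -> cint (fun x => z * f x) = z * cint f.
Proof.
move=> tf; have [i1 i2] := tame_cintegrable tf.
have iZ (a : R) (h : R * R -> R) : mu2.-integrable setT (EFin \o h) ->
    mu2.-integrable setT (EFin \o (fun x => a * h x)).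
  move=> ih; have := integrableZl measurableT a ih.
  by apply: eq_integrable => // x _ /=; rewrite EFinM.
rewrite /cint; case: z => a b; apply/eqP; rewrite eq_complex /=; apply/andP; split.
  rewrite -!RintegralZl // -RintegralB ?iZ //; apply/eqP.
  by apply: eq_Rintegral => x _; rewrite /reF /imF; case: (f x).
rewrite -!RintegralZl // -RintegralD ?iZ //; apply/eqP.
by apply: eq_Rintegral => x _; rewrite /reF /imF; case: (f x).
Qed.

Lemma cint_sum (J : Type) (r : seq J) (F : J -> R * R -> C) :
  (forall j, tame (F j)) ->
  cint (fun x => \sum_(j <- r) F j x) = \sum_(j <- r) cint (F j).
Proof.
move=> tF; elim: r => [|j r IH].
  rewrite big_nil (_ : (fun=> _) = fun=> 0) ?cint0 //.
  by apply/funext => x; rewrite big_nil.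
rewrite big_cons -IH -cintD //; last exact: tame_sum.
by congr cint; apply/funext => x; rewrite big_cons.
Qed.

Lemma cint_reflection f x : tame f -> cint (fun y => f (x - y)) = cint f.
Proof.
move=> [[c1 c2] [M fM]]; rewrite /cint; congr (_ +i* _).
  apply: (@Rintegral_reflection _ (reF f) x M) => // y.
  exact: le_trans (Re_le_cmod _) (fM y).
apply: (@Rintegral_reflection _ (imF f) x M) => // y.
exact: le_trans (Im_le_cmod _) (fM y).
Qed.

Definition decay_mass : R := (\int[mu2]_x decay x)%R.

(** The factor 2 comes from estimating real and imaginary parts separately. *)
Lemma cmod_cint_le f (M : R) : ccontinuous f ->
  (forall x, cmod (f x) <= M * decay x) -> cmod (cint f) <= 2 * M * decay_mass.
Proof.
move=> cf fM; have tf : tame f by split => //; exists M.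
have part (h : R * R -> R) : mu2.-integrable setT (EFin \o h) ->
    (forall x, `|h x| <= M * decay x) -> `|(\int[mu2]_x h x)%R| <= M * decay_mass.
  move=> ih hM; apply: le_trans (le_normr_Rintegral measurableT ih) _.
  rewrite /decay_mass -RintegralZl ?integrable_decay //.
  apply: le_Rintegral => //.
  - by have := integrable_abse ih.
  - have := integrableZl measurableT M integrable_decay.
    by apply: eq_integrable => // x _ /=; rewrite EFinM.
apply: le_trans (cmod_le_Re_Im _) _; rewrite -mulrA mulr_natl mulr2n.
apply: lerD; apply: part.
- exact: tame_integrable_Re.
- by move=> x; apply: le_trans (Re_le_cmod _) (fM x).
- exact: tame_integrable_Im.
- by move=> x; apply: le_trans (Im_le_cmod _) (fM x).
Qed.

Lemma cint_partial0 d f : cdifferentiable f -> tame f -> tame (partial d f) ->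
  cint (partial d f) = 0.
Proof.
move=> df [_ [M fM]] [[c1 c2] [M' f'M]].
have M0 := bound_ge0 fM; have M'0 := bound_ge0 f'M.
have fMM x : cmod (f x) <= (M + M') * decay x.
  by apply: le_trans (fM x) _; rewrite ler_wpM2r ?(ltW (decay_gt0 _)) // lerDl.
have f'MM x : cmod (partial d f x) <= (M + M') * decay x.
  by apply: le_trans (f'M x) _; rewrite ler_wpM2r ?(ltW (decay_gt0 _)) // lerDr.
rewrite /cint; apply/eqP; rewrite eq_complex /=; apply/andP; split; apply/eqP.
- apply: (@Rintegral_derive_dir0 _ (reF f) d (M + M')) => //.
  + by move=> x; have [] := df x.
  + by move=> x; apply: le_trans (Re_le_cmod _) (fMM x).
  + by move=> x; apply: le_trans (Re_le_cmod _) (f'MM x).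
- apply: (@Rintegral_derive_dir0 _ (imF f) d (M + M')) => //.
  + by move=> x; have [] := df x.
  + by move=> x; apply: le_trans (Im_le_cmod _) (fMM x).
  + by move=> x; apply: le_trans (Im_le_cmod _) (f'MM x).
Qed.

Lemma enorm_ge0 (x : R * R) : 0 <= enorm x.
Proof. exact: sqrtr_ge0. Qed.

(** Each factor [1 + x_i^2] is at most [(1 + |x|)^2]; hence the exponent 4, and the Schwartz
    seminorm of order 4 controls domination by [decay]. *)
Lemma decay_ge_enorm (x : R * R) : (1 + enorm x) ^+ 4 * decay x >= 1.
Proof.
have e0 := enorm_ge0 x.
have e2 : enorm x ^+ 2 = x.1 ^+ 2 + x.2 ^+ 2.
  by rewrite /enorm sqr_sqrtr /dotp -!expr2 // addr_ge0 ?sqr_ge0.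
have h1 : oneDsqr x.1 <= (1 + enorm x) ^+ 2.
  have := sqr_ge0 x.2; rewrite /oneDsqr sqrrD expr1n e2 mul1r; lra.
have h2 : oneDsqr x.2 <= (1 + enorm x) ^+ 2.
  have := sqr_ge0 x.1; rewrite /oneDsqr sqrrD expr1n e2 mul1r; lra.
have p1 := oneDsqr_gt0 x.1; have p2 := oneDsqr_gt0 x.2.
rewrite /decay -invfM ler_pdivlMr ?mulr_gt0 // mul1r.
by rewrite (_ : 4 = 2 + 2)%N // exprD ler_pM // ltW.
Qed.

Lemma le_decay_of_seminorm psi (M : R) x :
  (1 + enorm x) ^+ 4 * cmod (psi x) <= M -> cmod (psi x) <= M * decay x.
Proof.
move=> h; apply: (@le_trans _ _ ((1 + enorm x) ^+ 4 * cmod (psi x) * decay x)).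
  rewrite mulrAC -[leLHS]mul1r ler_wpM2r ?cmod_ge0 //; exact: decay_ge_enorm.
by rewrite ler_wpM2r // ltW // decay_gt0.
Qed.

Lemma schwartz_cdifferentiable psi : schwartz psi -> cdifferentiable psi.
Proof. by case=> s _; apply: (s [::]). Qed.

Lemma schwartz_tame psi : schwartz psi -> tame psi.
Proof.
move=> sp; split; first exact/cdifferentiable_ccontinuous/schwartz_cdifferentiable.
have [_ /(_ [::] 4%N)[M h]] := sp; exists M => x.
exact: le_decay_of_seminorm (h x).
Qed.

Lemma schwartz_partial d psi : schwartz psi -> schwartz (partial d psi).
Proof.
have e s : partials s (partial d psi) = partials (rcons s d) psi.
  by rewrite /partials foldr_rcons.
by case=> sm dec; split=> s *; rewrite e; [exact: sm|exact: dec].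
Qed.

End ComplexIntegral.

(** * Trigonometric polynomials *)

Section PlaneCalculus.
Context {R : realType}.
Local Notation C := (R[i]).
Implicit Types (f g psi : R * R -> C) (x y xi : R * R) (z : C).

Lemma reFM f g : reF (fun x => f x * g x) = reF f * reF g - imF f * imF g.
Proof.
by apply/funext => x; rewrite /reF /imF /= !fctE; case: (f x) (g x) => a b [].
Qed.

Lemma imFM f g : imF (fun x => f x * g x) = reF f * imF g + imF f * reF g.
Proof.
by apply/funext => x; rewrite /reF /imF /= !fctE; case: (f x) (g x) => a b [].
Qed.

Lemma reFD f g : reF (fun x => f x + g x) = reF f + reF g.
Proof. by apply/funext => x; rewrite /reF /= raddfD. Qed.

Lemma imFD f g : imF (fun x => f x + g x) = imF f + imF g.
Proof. by apply/funext => x; rewrite /imF /= raddfD. Qed.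

Lemma cdifferentiableD f g : cdifferentiable f -> cdifferentiable g ->
  cdifferentiable (fun x => f x + g x).
Proof.
move=> df dg x; have [f1 f2] := df x; have [g1 g2] := dg x.
by rewrite reFD imFD; split; apply: differentiableD.
Qed.

Lemma cdifferentiableM f g : cdifferentiable f -> cdifferentiable g ->
  cdifferentiable (fun x => f x * g x).
Proof.
move=> df dg x; have [f1 f2] := df x; have [g1 g2] := dg x.
rewrite reFM imFM; split.
  by apply: differentiableB; apply: differentiableM.
by apply: differentiableD; apply: differentiableM.
Qed.

Lemma cdifferentiable_cst z : cdifferentiable (fun=> z).
Proof. by move=> x; split; apply: differentiable_cst. Qed.

Lemma partialD d f g : cdifferentiable f -> cdifferentiable g ->
  partial d (fun x => f x + g x) = fun x => partial d f x + partial d g x.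
Proof.
move=> df dg; apply/funext => x; have [f1 f2] := df x; have [g1 g2] := dg x.
rewrite /partial reFD imFD !deriveD //; exact: diff_derivable.
Qed.

Lemma partialM d f g : cdifferentiable f -> cdifferentiable g ->
  partial d (fun x => f x * g x) =
  fun x => partial d f x * g x + f x * partial d g x.
Proof.
move=> df dg; apply/funext => x; have [f1 f2] := df x; have [g1 g2] := dg x.
have drv (h : R * R -> R) : differentiable h x -> derivable h x (dir d).
  by move=> dh; apply: diff_derivable.
rewrite /partial reFM imFM deriveB ?deriveD ?deriveM; try by [apply: drv|apply: derivableM; apply: drv].
set a := 'D_(dir d) (reF f) x; set b := 'D_(dir d) (imF f) x.
set a' := 'D_(dir d) (reF g) x; set b' := 'D_(dir d) (imF g) x.
rewrite /reF /imF; case: (f x) => u v; case: (g x) => u' v' /=.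
by apply/eqP; rewrite eq_complex /= /GRing.scale /=; apply/andP; split; apply/eqP; ring.
Qed.

Lemma partial_cst d z : partial d (fun=> z) = fun=> 0.
Proof.
by apply/funext => x; rewrite /partial; rewrite !derive_cst.
Qed.

Definition wave xi : R * R -> C := fun x => cis (dotp x xi).

Lemma differentiable_dotp xi x : differentiable (fun x => dotp x xi) x.
Proof.
apply: (@differentiableD _ _ _ (fun x : R * R => x.1 * xi.1) (fun x => x.2 * xi.2)).
  apply: (@differentiableM _ _ (fun x : R * R => x.1) (fun=> xi.1)).
    apply: linear_differentiable => y; exact: cvg_fst.
  exact: differentiable_cst.
apply: (@differentiableM _ _ (fun x : R * R => x.2) (fun=> xi.2)).
  apply: linear_differentiable => y; exact: cvg_snd.
exact: differentiable_cst.
Qed.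

Lemma cdifferentiable_wave xi : cdifferentiable (wave xi).
Proof.
move=> x; split.
  apply: (@differentiable_comp _ _ _ _ (fun x => dotp x xi) cos).
    exact: differentiable_dotp.
  by apply/derivable1_diffP.
apply: (@differentiable_comp _ _ _ _ (fun x => dotp x xi) sin).
  exact: differentiable_dotp.
by apply/derivable1_diffP.
Qed.

Definition coord (d : bool) xi : R := if d then xi.2 else xi.1.

(** Reduces a partial derivative to one along a coordinate line, where the one-variable chain rule
    applies. *)
Lemma derive_slice (f : R * R -> R) (d : bool) x (D : R) : differentiable f x ->
  is_derive (coord d x) (1 : R) (fun t => f (if d then (x.1, t) else (t, x.2))) D ->
  'D_(dir d) f x = D.
Proof.
case: x => x1 x2 df [_ <-] /=.
have := @slice_derive _ f d (if d then x1 else x2) (if d then x2 else x1).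
by case: d => /= /(_ df) [_ ->].
Qed.

Lemma partial_wave d xi :
  partial d (wave xi) = fun x => (0 +i* coord d xi) * wave xi x.
Proof.
apply/funext => x; have [d1 d2] := cdifferentiable_wave xi x.
have line : is_derive (coord d x) (1 : R)
    (fun t => dotp (if d then (x.1, t) else (t, x.2)) xi) (coord d xi).
  have aff (a b : R) (t : R) : is_derive t (1 : R) (fun t => t * a + b) a.
    have -> : (fun t => t * a + b) = (a \*: id) + cst b.
      by apply/funext => u; rewrite !fctE /= mulrC.
    by apply: is_derive_eq; rewrite addr0 [_ *: _]mulr1.
  rewrite /dotp /coord; case: d {d1 d2} => /=.
    rewrite (_ : (fun t => _) = fun t => t * xi.2 + x.1 * xi.1); first exact: aff.
    by apply/funext => t; rewrite addrC.
  exact: aff.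
have xE : (if d then (x.1, coord d x) else (coord d x, x.2)) = x.
  by case: (d) => /=; case: (x).
have reD : 'D_(dir d) (reF (wave xi)) x = - sin (dotp x xi) * coord d xi.
  apply: (derive_slice d1).
  by have := is_derive1_comp (is_derive_cos _) line; rewrite xE.
have imD : 'D_(dir d) (imF (wave xi)) x = cos (dotp x xi) * coord d xi.
  apply: (derive_slice d2).
  by have := is_derive1_comp (is_derive_sin _) line; rewrite xE.
rewrite /partial reD imD; apply/eqP; rewrite eq_complex /= !mul0r sub0r add0r.
by rewrite mulNr ![coord d xi * _]mulrC !eqxx.
Qed.

End PlaneCalculus.

(** * The dyadic partition of unity *)

Section DyadicPartition.
Context {R : realType} (w : R -> R).
Hypothesis hw : dyadic_window w.

Lemma window_gt2 t : 2 < t -> w t = 0.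
Proof.
have [_ _ sw _] := hw => t2; apply/eqP; apply: contraT => /sw /andP[_].
by rewrite leNgt t2.
Qed.

Lemma window_lt t : t < 2^-1 -> w t = 0.
Proof.
have [_ _ sw _] := hw => t2; apply/eqP; apply: contraT => /sw /andP[+ _].
by rewrite leNgt t2.
Qed.

(** The closed support condition leaves the endpoint open; continuity there settles it, as [w]
    vanishes to the right. *)
Lemma window2 : w 2 = 0.
Proof.
have [_ dw _ _] := hw; apply/eqP; apply: contraT => w2.
have /derivable1_diffP/differentiable_continuous cw : derivable w 2 1 by apply: (dw 0%N).
have w2' : 0 < `|w 2| by rewrite normr_gt0.
have /cvgrPdist_lt/(_ _ w2')/nbhs_ballP[e /= e0 he] := cw.
have : ball (2 : R) e (2 + e / 2).
  by rewrite /ball /= opprD addrA subrr sub0r normrN gtr0_norm ?divr_gt0 // ltr_pdivrMr // ltr_pMr // ltr1n.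
by move/he => /=; rewrite (window_gt2 (t := 2 + e / 2)) ?ltrDl ?divr_gt0 // subr0 ltxx.
Qed.

(* [w s = low s - low (2 s)], which makes the dyadic sums telescope. *)
Let low (s : R) : R := if s < 1 then 1 else w s.

Let window_low s : w s = low s - low (2 * s).
Proof.
have [_ _ _ w1] := hw; rewrite /low; have [s1|s1] := ltP s 1; last first.
  have -> : (2 * s < 1) = false by apply/negbTE; rewrite -leNgt; lra.
  have [->|s1'] := eqVneq s 1; first by rewrite mulr1 window2 subr0.
  have s1lt : 1 < s by rewrite lt_neqAle eq_sym s1'.
  by rewrite (window_gt2 (t := 2 * s)) ?subr0 //; lra.
have [s2|s2] := ltP (2 * s) 1; first by rewrite subrr window_lt //; lra.
(* The only range in which the two-scale relation enters: [w (2 * s) = 1 - w s]. *)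
have h2 : 1 <= 2 * s <= 2 by apply/andP; split; lra.
rewrite (w1 _ h2) (_ : 2 * s / 2 = s); last by field.
by ring.
Qed.

(** The sum telescopes to [low (2^(1-N) s) - low (2^(N+1) s)], which is exactly [1 - 0] for large
    [N]. The grouping of terms is that of the two-sided series in [besov]. *)
Lemma dyadic_partition s : 0 < s ->
  \forall N \near \oo, \sum_(k < N) (w (2 ^- k * s) + w (2 ^+ k.+1 * s)) = 1.
Proof.
move=> s0.
have tel (N : nat) : \sum_(k < N) (w (2 ^- k * s) + w (2 ^+ k.+1 * s)) =
   low (2 * (2 ^- N * s)) - low (2 ^+ N.+1 * s).
  elim: N => [|N IH]; first by rewrite big_ord0 expr0 invr1 mul1r expr1 subrr.
  rewrite big_ord_recr /= IH (window_low (2 ^- N * s)) (window_low (2 ^+ N.+1 * s)).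
  have -> : 2 * (2 ^- N.+1 * s) = 2 ^- N * s.
    rewrite exprS invfM !mulrA divff ?mul1r //.
  rewrite [2 * (2 ^+ N.+1 * s)]mulrA -exprS; ring.
pose N0 := maxn (Num.bound (2 * s)) (Num.bound (2 / s)).
have pow (N : nat) (b : R) : 0 <= b -> (Num.bound b <= N)%N -> b < 2 ^+ N.
  move=> b0 bN; apply: lt_le_trans (archi_boundP b0) _.
  by rewrite -natrX ler_nat (leq_trans bN) // ltnW // ltn_expl.
exists N0 => // N /=; rewrite /N0 geq_max => /andP[h1 h2]; rewrite tel /low.
have p1 := pow N (2 * s) (mulr_ge0 (ler0n _ 2) (ltW s0)) h1.
have p2 := pow N (2 / s) (divr_ge0 (ler0n _ 2) (ltW s0)) h2.
have q0 : 0 < 2 ^+ N :> R by rewrite exprn_gt0.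
have -> : 2 * (2 ^- N * s) < 1.
  by rewrite mulrCA mulrC ltr_pdivrMr // mul1r.
have p3 : 2 < 2 ^+ N * s by move: p2; rewrite ltr_pdivrMr.
have p4 : 2 < 2 ^+ N.+1 * s by rewrite exprS -mulrA; lra.
have -> : (2 ^+ N.+1 * s < 1) = false by apply/negbTE; rewrite -leNgt; lra.
by rewrite (window_gt2 p4) subr0.
Qed.

End DyadicPartition.

(** * Convolution and integration by parts for trigonometric polynomials *)

Section TrigPolynomial.
Context {R : realType}.
Local Notation C := (R[i]).
Implicit Types (f g psi : R * R -> C) (x y xi : R * R) (z : C).

Lemma wave_bdd xi : bdd_continuous (wave xi).
Proof.
split; first exact/cdifferentiable_ccontinuous/cdifferentiable_wave.
by exists 1 => x; rewrite cmod_cis.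
Qed.

Lemma dotpBl x y xi : dotp (x - y) xi = dotp x xi - dotp y xi.
Proof. by rewrite /dotp /=; ring. Qed.

Lemma dotpNr x xi : dotp x (- xi) = - dotp x xi.
Proof. by rewrite /dotp /=; ring. Qed.

Lemma dotpZ (s : R) x xi : dotp (s *: x) xi = s * dotp x xi.
Proof. by rewrite /dotp /= /GRing.scale /=; ring. Qed.

Lemma dotpZr (s : R) x xi : dotp x (s *: xi) = s * dotp x xi.
Proof. by rewrite /dotp /= /GRing.scale /=; ring. Qed.

Lemma enormZ (s : R) xi : 0 <= s -> enorm (s *: xi) = s * enorm xi.
Proof.
move=> s0; rewrite /enorm dotpZ dotpZr mulrA -expr2 sqrtrM ?sqr_ge0 //.
by rewrite sqrtr_sqr ger0_norm.
Qed.

Lemma waveN xi x : wave (- xi) x = cis (- dotp x xi).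
Proof. by rewrite /wave dotpNr. Qed.

Lemma wave_sub xi x y : wave xi (x - y) = wave xi x * wave (- xi) y.
Proof. by rewrite /wave dotpBl cisD dotpNr. Qed.

Section Sums.
Variables (J : finType).
Implicit Types (c : J -> C) (k : J -> R * R).

Definition trig c k : R * R -> C := fun x => \sum_j c j * wave (k j) x.

Lemma cdifferentiable_sum (F : J -> R * R -> C) d :
  (forall j, cdifferentiable (F j)) ->
  cdifferentiable (fun x => \sum_j F j x) /\
  partial d (fun x => \sum_j F j x) = fun x => \sum_j partial d (F j) x.
Proof.
move=> dF; elim: (index_enum J) => [|j r [IH1 IH2]].
  have -> : (fun x => \sum_(j <- [::]) F j x) = fun=> 0.
    by apply/funext => x; rewrite big_nil.
  split; first exact: cdifferentiable_cst.
  by rewrite partial_cst; apply/funext => x; rewrite big_nil.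
have -> : (fun x => \sum_(j <- j :: r) F j x) = fun x => F j x + \sum_(j <- r) F j x.
  by apply/funext => x; rewrite big_cons.
split; first exact: cdifferentiableD.
by rewrite partialD // IH2; apply/funext => x; rewrite big_cons.
Qed.

Let cdiff_term c k j : cdifferentiable (fun x => c j * wave (k j) x).
Proof. by apply: cdifferentiableM; [exact: cdifferentiable_cst|exact: cdifferentiable_wave]. Qed.

Lemma cdifferentiable_trig c k : cdifferentiable (trig c k).
Proof. by have [] := cdifferentiable_sum false (cdiff_term c k). Qed.

Lemma partial_trig d c k :
  partial d (trig c k) = trig (fun j => c j * (0 +i* coord d (k j))) k.
Proof.
have [_ ->] := cdifferentiable_sum d (cdiff_term c k).
apply/funext => x; apply: eq_bigr => j _.
rewrite partialM ?partial_cst ?partial_wave; [|exact: cdifferentiable_cst|exact: cdifferentiable_wave].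
by rewrite mul0r add0r mulrA.
Qed.

Lemma trig_bdd c k : bdd_continuous (trig c k).
Proof.
apply: (@bdd_continuous_sum _ _ _ (fun j x => c j * wave (k j) x)) => j.
by apply: bdd_continuousM; [exact: bdd_continuous_cst|exact: wave_bdd].
Qed.

Lemma C1_trig c k : C1 (trig c k).
Proof.
split; first exact: cdifferentiable_trig.
by move=> d; rewrite partial_trig; have [] := trig_bdd (fun j => c j * (0 +i* coord d (k j))) k.
Qed.

Lemma cint_trig c k psi : tame psi ->
  cint (fun x => trig c k x * psi x) = \sum_j c j * cint (fun x => wave (k j) x * psi x).
Proof.
move=> tp; have tw j : tame (fun x => wave (k j) x * psi x).
  by apply: tameM => //; exact: wave_bdd.
under eq_bigr do rewrite -cintZ //.
rewrite -cint_sum => [|j]; last exact: tameZ.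
by congr cint; apply/funext => x; rewrite mulr_suml; apply: eq_bigr => j _; rewrite mulrA.
Qed.

(** Plane waves are eigenfunctions of convolution; the substitution of [x - y] for [y] brings out
    the Fourier transform of [psi]. *)
Lemma conv_trig c k psi : schwartz psi ->
  conv_distr (distr_of (trig c k)) psi = trig (fun j => c j * fourier psi (k j)) k.
Proof.
move=> /schwartz_tame tp; apply/funext => x.
rewrite /conv_distr /distr_of.
pose h y := trig (fun j => c j * wave (k j) x) (fun j => - k j) y * psi y.
transitivity (cint (fun y => h (x - y))).
  congr cint; apply/funext => y; rewrite /h; congr (_ * _).
  apply: eq_bigr => j _; rewrite -mulrA -wave_sub.
  by rewrite opprB addrC subrK.
rewrite cint_reflection; last by apply: tameM => //; exact: trig_bdd.
rewrite cint_trig //; apply: eq_bigr => j _.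
rewrite /fourier mulrAC; congr (_ * cint _ * _).
by apply/funext => y; rewrite waveN mulrC.
Qed.

(** The left side is the integral of [trig c k (x - s y) psi(y)] over [y], so the bound depends on
    the supremum of the polynomial and on [psi], but not on the scale [s]. *)
Lemma trig_dilation_bound c k psi (M M' s : R) :
  ccontinuous psi -> (forall x, cmod (psi x) <= M' * decay x) ->
  (forall x, cmod (trig c k x) <= M) ->
  forall x, cmod (trig (fun j => c j * fourier psi (s *: k j)) k x)
     <= 2 * (M * M') * decay_mass.
Proof.
move=> cpsi psiM trigM x.
have tp : tame psi by split => //; exists M'.
pose h y := trig (fun j => c j * wave (k j) x) (fun j => - (s *: k j)) y * psi y.
have hE y : h y = trig c k (x - s *: y) * psi y.
  rewrite /h; congr (_ * _); apply: eq_bigr => j _.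
  by rewrite -mulrA wave_sub; congr (_ * (_ * _)); rewrite !waveN dotpZ dotpZr.
have -> : trig (fun j => c j * fourier psi (s *: k j)) k x = cint h.
  rewrite cint_trig //; apply: eq_bigr => j _.
  rewrite /fourier mulrAC; congr (_ * cint _).
  by apply/funext => y; rewrite waveN mulrC.
apply: cmod_cint_le.
  by apply: ccontinuousM => //; have [] := trig_bdd (fun j => c j * wave (k j) x) (fun j => - (s *: k j)).
by move=> y; rewrite hE cmodM -mulrA ler_pM ?cmod_ge0.
Qed.

(** The integral of the derivative of the product [wave xi x * psi x] is 0. *)
Lemma wave_by_parts d xi psi : schwartz psi ->
  cint (fun x => wave xi x * partial d psi x) =
  - ((0 +i* coord d xi) * cint (fun x => wave xi x * psi x)).
Proof.
move=> sp; have tp := schwartz_tame sp.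
have tdp := schwartz_tame (schwartz_partial d sp).
have dp := schwartz_cdifferentiable sp; have dwv := cdifferentiable_wave xi.
have e : partial d (fun x => wave xi x * psi x) =
    fun x => (0 +i* coord d xi) * (wave xi x * psi x) + wave xi x * partial d psi x.
  by rewrite partialM // partial_wave; apply/funext => x; rewrite mulrA.
have t1 : tame (fun x => wave xi x * psi x) by apply: tameM => //; exact: wave_bdd.
have t2 : tame (fun x => wave xi x * partial d psi x) by apply: tameM => //; exact: wave_bdd.
have := cint_partial0 (d := d) (cdifferentiableM dwv dp) t1.
rewrite e => /(_ (tameD (tameZ _ t1) t2)).
rewrite cintD //; last exact: tameZ.
by rewrite cintZ // => /eqP; rewrite addr_eq0 => /eqP ->; rewrite opprK.
Qed.

End Sums.
End TrigPolynomial.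

(** * Trigonometric polynomials in the Besov class *)

(** A geometric series: the powers [2^n] with [n <= 5] add up to 64. *)
Lemma esum_dyadic_le (R : realType) (a : int -> \bar R) (B : R) :
  0 <= B -> (forall n, 6 <= n -> a n = 0%E) ->
  (forall n, (0 <= a n)%E) ->
  (forall n, (a n <= ((2 : R) ^ n * B)%:E)%E) ->
  (\esum_(n in [set: int]) a n <= (64 * B)%:E)%E.
Proof.
move=> B0 a6 a0 aB.
have -> : \esum_(n in [set: int]) a n = \esum_(n in [set n : int | n < 6]) a n.
  rewrite [RHS]esum_mkcond; apply: eq_esum => n _.
  case: ifPn => //; rewrite notin_setE /= => /negP; rewrite -leNgt; exact: a6.
rewrite (reindex_esum [set: nat] _ (fun k : nat => 5 - k%:Z)); last first.
  split=> [k _ /=|j k _ _ /= /eqP|n /= n6]; first by lia.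
    by rewrite (inj_eq (addrI _)) eqr_opp => /eqP [].
  by exists `|5 - n|%N => //; lia.
rewrite -nneseries_esumT //.
apply: lime_le; first exact: is_cvg_nneseries.
apply: nearW => N.
apply: (@le_trans _ _ (\sum_(0 <= k < N) (32 * B * 2 ^- k)%:E)%E).
  apply: lee_sum => k _; apply: le_trans (aB _) _; rewrite lee_fin.
  rewrite expfzDr // -exprnN.
  have -> : (2 : R) ^ (5 : int) = 32 by rewrite -[LHS]natrX.
  by rewrite mulrAC.
rewrite sumEFin lee_fin -mulr_sumr.
have geo : \sum_(0 <= k < N) (2 ^- k : R) = 2 - 2 * 2 ^- N.
  elim: N => [|N IH]; first by rewrite big_geq // expr0 invr1 mulr1 subrr.
  by rewrite big_nat_recr //= IH [in RHS]exprS invfM mulrA divff // mul1r; ring.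
have g2 : \sum_(0 <= k < N) (2 ^- k : R) <= 2.
  by rewrite geo gerBl mulr_ge0 // invr_ge0 exprn_ge0.
have := ler_wpM2l (mulr_ge0 (ler0n R 32) B0) g2; lra.
Qed.

Section BesovTrig.
Context {R : realType} (w : R -> R) (W : int -> R * R -> R[i]).
Hypotheses (hw : dyadic_window w) (hW : dyadic_kernels w W).
Local Notation C := (R[i]).
Implicit Types (psi : R * R -> C).

(** Both sides are values of the radial window [w]; thus every scale is reduced to the single kernel
    [W 0]. *)
Let fourier_kernel_dilation (n : int) xi :
  fourier (W n) xi = fourier (W 0) ((2 : R) ^ (- n) *: xi).
Proof.
rewrite (hW n).2 (hW 0).2 oppr0 expr0z mul1r enormZ //.
by rewrite exprz_ge0.
Qed.

Lemma Lnormy_le (g : R * R -> C) (B : R) : 0 <= B ->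
  (forall x, cmod (g x) <= B) -> ('N[mu2]_+oo[EFin \o cmod \o g] <= B%:E)%E.
Proof.
move=> B0 gB; rewrite unlock; case: ifP => _; last by rewrite lee_fin.
apply/ess_supP; apply: aeW => x /=.
by rewrite lee_fin ger0_norm ?cmod_ge0.
Qed.

Section Fixed.
Variables (J : finType) (c : J -> C) (k : J -> R * R).
Hypotheses (c1 : forall x, cmod (trig c k x) <= 1) (k16 : forall j, enorm (k j) <= 16).

Let phi := trig c k.

Lemma conv_kernel n : conv_distr (distr_of phi) (W n) =
  trig (fun j => c j * (w ((2 : R) ^ (- n) * enorm (k j)))%:C) k.
Proof.
rewrite conv_trig; last by have [] := hW n.
by congr (trig _ _); apply/funext => j; rewrite (hW n).2.
Qed.

Lemma conv_kernel_high n : 6 <= n -> conv_distr (distr_of phi) (W n) = fun=> 0.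
Proof.
move=> n6; rewrite conv_kernel; apply/funext => x; rewrite /trig big1 // => j _.
rewrite (window_lt hw) ?mulr0 ?mul0r //.
(* This number is [1/4], to the left of the support of [w]; it fixes the threshold 6 for frequencies
   of length at most 16. *)
apply: (@le_lt_trans _ _ ((2 : R) ^ (- 6 : int) * 16)).
  rewrite ler_pM ?exprz_ge0 ?enorm_ge0 //.
  by rewrite ler_weXz2l ?ler1n // lerN2.
rewrite -exprnN ltr_pdivrMl ?exprn_gt0 //.
by rewrite (exprS _ 5) mulrAC mulfV // mul1r -natrX ltr_nat.
Qed.

Lemma conv_kernel_le n (M' : R) x : (forall x, cmod (W 0 x) <= M' * decay x) ->
  cmod (conv_distr (distr_of phi) (W n) x) <= 2 * M' * decay_mass.
Proof.
move=> WM; have sW : schwartz (W 0) by have [] := hW 0.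
rewrite conv_trig; last by have [] := hW n.
have -> : (fun j => c j * fourier (W n) (k j)) =
          (fun j => c j * fourier (W 0) ((2 : R) ^ (- n) *: k j)).
  by apply/funext => j; rewrite fourier_kernel_dilation.
have := trig_dilation_bound ((2 : R) ^ (- n)) (schwartz_tame sW).1 WM c1 x.
by rewrite mul1r.
Qed.

Lemma decay_mass_ge0 : 0 <= @decay_mass R.
Proof. by apply: Rintegral_ge0 => x _; apply/ltW/decay_gt0. Qed.

Lemma besov_norm_trig_le (M' : R) : (forall x, cmod (W 0 x) <= M' * decay x) ->
  (besov_norm W (distr_of phi) <= (64 * (2 * M' * decay_mass))%:E)%E.
Proof.
move=> WM; have B0 : 0 <= 2 * M' * @decay_mass R.
  by rewrite !mulr_ge0 ?decay_mass_ge0 ?(bound_ge0 WM).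
have p0 (n : int) : 0 <= (2 : R) ^ n by rewrite exprz_ge0.
apply: esum_dyadic_le => // n.
- move=> n6; rewrite conv_kernel_high // (_ : _ \o _ = cst 0%E).
    by rewrite Lnorm0 ?mule0.
  by apply/funext => x /=; rewrite cmod0.
- by rewrite mule_ge0 ?lee_fin // Lnorm_ge0.
- rewrite EFinM lee_wpmul2l ?lee_fin // Lnormy_le // => x.
  exact: conv_kernel_le.
Qed.

Lemma tempered_trig : tempered_distribution (distr_of phi).
Proof.
have bphi := trig_bdd c k.
split=> [a f psi sf sp|].
  have tf := schwartz_tame sf; have tp := schwartz_tame sp.
  have t1 := tameM bphi tf; have t2 := tameM bphi tp.
  rewrite /distr_of -cintZ // -cintD //; last exact: tameZ.
  by congr cint; apply/funext => x; rewrite mulrDr mulrCA.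
exists 4%N, (2 * @decay_mass R) => psi M sp hM.
have tp := schwartz_tame sp.
rewrite mulrAC; apply: cmod_cint_le.
  by apply: ccontinuousM; [exact: bphi.1|exact: tp.1].
move=> x; rewrite cmodM.
apply: le_trans (le_decay_of_seminorm (hM [::] isT x)).
by rewrite -[leRHS]mul1r ler_wpM2r ?cmod_ge0.
Qed.

(** Each frequency is weighted by a partial sum of the dyadic partition, which is eventually equal
    to 1. There are finitely many frequencies, so the series is eventually constant. *)
Lemma besov_series d psi : schwartz psi ->
  ccvg (fun N : nat => \sum_(m < N)
          (distr_of (partial d (conv_distr (distr_of phi) (W m%:Z))) psi +
           distr_of (partial d (conv_distr (distr_of phi) (W (- m.+1%:Z)))) psi))
       (deriv_distr d (distr_of phi) psi).
Proof.
move=> sp; have tp := schwartz_tame sp.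
have tdp := schwartz_tame (schwartz_partial d sp).
pose I j : C := c j * (0 +i* coord d (k j)) * cint (fun x => wave (k j) x * psi x).
have -> : deriv_distr d (distr_of phi) psi = \sum_j I j.
  rewrite /deriv_distr /distr_of cint_trig // -sumrN; apply: eq_bigr => j _.
  by rewrite wave_by_parts // mulrN opprK /I mulrA.
have term n : distr_of (partial d (conv_distr (distr_of phi) (W n))) psi =
    \sum_j (w ((2 : R) ^ (- n) * enorm (k j)))%:C * I j.
  rewrite conv_kernel partial_trig /distr_of cint_trig //; apply: eq_bigr => j _.
  by rewrite /I !mulrA; congr (_ * _ * _); rewrite mulrC.
pose S N j := \sum_(m < N) (w (2 ^- m * enorm (k j)) + w (2 ^+ m.+1 * enorm (k j))).
have sumE N : \sum_(m < N)
          (distr_of (partial d (conv_distr (distr_of phi) (W m%:Z))) psi +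
           distr_of (partial d (conv_distr (distr_of phi) (W (- m.+1%:Z)))) psi)
   = \sum_j (S N j)%:C * I j.
  under eq_bigr => m _ do rewrite !term -big_split /=.
  rewrite exchange_big /=; apply: eq_bigr => j _.
  rewrite /S rmorph_sum mulr_suml; apply: eq_bigr => m _.
  by rewrite -mulrDl rmorphD /= opprK -exprnN -exprnP.
rewrite /ccvg; apply: cvg_near_cst.
have : \forall N \near \oo, forall j, (S N j)%:C * I j = I j.
  apply: filter_forall => j.
  (* The partition misses the zero frequency, but a constant term has zero derivative and
     contributes [I j = 0]. *)
  have [k0|k0] := eqVneq (enorm (k j)) 0; last first.
    have : 0 < enorm (k j) by rewrite lt_neqAle eq_sym k0 enorm_ge0.
    by move/(dyadic_partition hw); apply: filterS => N SN; rewrite /S SN mul1r.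
  have -> : I j = 0.
    rewrite /I (_ : coord d (k j) = 0); first by rewrite (_ : 0 +i* 0 = 0) // mulr0 mul0r.
    move: k0; rewrite /enorm /dotp => /eqP; rewrite sqrtr_eq0 -!expr2 => h.
    have s1 := sqr_ge0 (k j).1; have s2 := sqr_ge0 (k j).2.
    by rewrite /coord; case: (d); apply/eqP; rewrite -sqrf_eq0; apply/eqP; lra.
  by apply: nearW => N; rewrite mulr0.
apply: filterS => N hN; by rewrite sumE (eq_bigr I) ?subrr ?cmod0.
Qed.

End Fixed.

(** What matters is the order of quantifiers: [B] comes from the decay of [W 0] alone and serves all
    polynomials, whatever their number of terms. *)
Theorem besov_trig : exists B : R, forall (J : finType) (c : J -> C) (k : J -> R * R),
  (forall x, cmod (trig c k x) <= 1) -> (forall j, enorm (k j) <= 16) ->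
  besov_function W (trig c k) /\ (besov_norm W (distr_of (trig c k)) <= B%:E)%E.
Proof.
have [_ [M' WM]] := schwartz_tame (hW 0).1.
exists (64 * (2 * M' * decay_mass)) => J c k c1 k16.
have nB := besov_norm_trig_le c1 k16 WM; split => //; split.
- exact: C1_trig.
- move=> psi /schwartz_tame tp; apply: tame_cintegrable; apply: tameM => //.
  exact: trig_bdd.
- split.
  + exact: tempered_trig.
  + by apply: le_lt_trans nB _; rewrite ltry.
  + by move=> d psi sp; apply: besov_series.
Qed.

End BesovTrig.

(** * Interpolation by Fejer kernels *)

Section Fejer.
Context {R : realType} (N : nat).
Hypothesis N0 : (0 < N)%N.
Local Notation C := (R[i]).
Implicit Types (t : R).

Let freq (k : 'I_N) : R := 2 * pi * k%:R / N%:R.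
Let dfreq (p : 'I_N * 'I_N) : R := freq p.1 - freq p.2.

(** The Fejer kernel of period [N], normalised to be 1 at 0 and expanded into exponentials. Its
    frequencies lie in a range that does not grow with [N]. *)
Definition fejer t : C := \sum_p N%:R ^- 2 * cis (dfreq p * t).

Let NC_neq0 : (N%:R : C) != 0.
Proof. by rewrite pnatr_eq0 -lt0n. Qed.

Let N_neq0 : (N%:R : R) != 0.
Proof. by rewrite pnatr_eq0 -lt0n. Qed.

Let dirichlet t : C := \sum_k cis (freq k * t).

Lemma fejerE t : fejer t = (cmod (dirichlet t) ^+ 2 / N%:R ^+ 2)%:C.
Proof.
rewrite /fejer -mulr_sumr mulrC rmorphM /= fmorphV /= !rmorphXn /= rmorph_nat.
congr (_ / _); rewrite -normc_real normCK /dirichlet rmorph_sum big_distrlr /=.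
rewrite pair_bigA /=; apply: eq_bigr => p _.
by rewrite conj_cis -cisD /dfreq mulrBl.
Qed.

Lemma cmod_fejer t : (cmod (fejer t))%:C = fejer t.
Proof.
by rewrite fejerE cmod_real // divr_ge0 ?exprn_ge0 ?cmod_ge0.
Qed.

(** At integers the Dirichlet sum is a sum of roots of unity; this is the interpolation property. *)
Lemma fejer_nat (j l : 'I_N) : fejer (j%:R - l%:R) = (j == l)%:R.
Proof.
have -> : fejer (j%:R - l%:R) = (cmod (dirichlet (j%:R - l%:R)) ^+ 2 / N%:R ^+ 2)%:C.
  exact: fejerE.
have -> : dirichlet (j%:R - l%:R) = (j == l)%:R * N%:R.
  rewrite -sum_cis_orth; apply: eq_bigr => k _; congr cis; rewrite /freq; by ring.
case: eqP => _; last by rewrite mul0r cmod0 expr0n mul0r.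
have -> : (N%:R : C) = (N%:R)%:C by rewrite rmorph_nat.
rewrite mul1r cmod_real ?ler0n //.
by rewrite mulfV // expf_neq0.
Qed.

(** Summation over the shifts cancels all pairs of distinct frequencies; each of the [N] diagonal
    pairs contributes [1/N]. *)
Lemma sum_fejer t : \sum_(j < N) fejer (t - j%:R) = 1.
Proof.
rewrite /fejer exchange_big /=.
rewrite (eq_bigr (fun p : 'I_N * 'I_N => N%:R^-1 * (p.1 == p.2)%:R)); last first.
  move=> [k l] _ /=; rewrite -mulr_sumr.
  rewrite (eq_bigr (fun j : 'I_N => cis (dfreq (k, l) * t) *
      cis (2 * pi * (l%:R - k%:R) / N%:R * j%:R))); last first.
    move=> j _; rewrite -cisD; congr cis; rewrite /dfreq /freq /=; by ring.
  rewrite -mulr_sumr sum_cis_orth eq_sym; case: eqP => [->|_]; last by rewrite mul0r !mulr0.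
  rewrite /dfreq /= subrr mul0r cis0 !mul1r mulr1 expr2 invfM -mulrA mulVf // mulr1 //.
rewrite -(pair_bigA _ (fun k l : 'I_N => N%:R^-1 * (k == l)%:R : C)) /=.
rewrite (eq_bigr (fun=> N%:R^-1)) => [|k _].
  by rewrite sumr_const card_ord -[_ *+ N]mulr_natr mulVf.
rewrite -mulr_sumr (bigD1 k) //= eqxx big1 ?addr0 ?mulr1 // => l /negPf.
by rewrite eq_sym => ->.
Qed.

Variable a : 'I_N -> 'I_N -> C.

(** An index consists of a grid point and of one pair of frequencies for each variable. *)
Let J : finType := (('I_N * 'I_N) * (('I_N * 'I_N) * ('I_N * 'I_N)))%type.
Let coef (q : J) : C := a q.1.1 q.1.2 *
  ((N%:R ^- 2 * cis (- (dfreq q.2.1 * q.1.1%:R))) *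
   (N%:R ^- 2 * cis (- (dfreq q.2.2 * q.1.2%:R)))).
Let fr (q : J) : R * R := (dfreq q.2.1, dfreq q.2.2).

Lemma trig_fejer x : trig coef fr x =
  \sum_(p : 'I_N * 'I_N) a p.1 p.2 * (fejer (x.1 - p.1%:R) * fejer (x.2 - p.2%:R)).
Proof.
rewrite /trig.
rewrite -(pair_bigA _ (fun p q => coef (p, q) * wave (fr (p, q)) x)) /=.
apply: eq_bigr => -[j l] _ /=.
rewrite /fejer big_distrlr /= pair_bigA mulr_sumr; apply: eq_bigr => -[p q] _ /=.
have e (d t s : R) : cis (d * (t - s)) = cis (- (d * s)) * cis (t * d) :> C.
  by rewrite -cisD; congr cis; ring.
by rewrite /coef /fr /wave /dotp /= (e (dfreq p)) (e (dfreq q)) cisD; ring.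
Qed.

Hypothesis a1 : forall j l, cmod (a j l) <= 1.

(** The interpolant is a convex combination of the values [a j l], hence bounded by 1. *)
Lemma fejer_interpolation : exists (J : finType) (c : J -> C) (k : J -> R * R),
  [/\ forall x, cmod (trig c k x) <= 1, forall j, enorm (k j) <= 16 &
      forall j l : 'I_N, trig c k (j%:R, l%:R) = a j l].
Proof.
exists J, coef, fr; split.
- move=> x; rewrite trig_fejer; apply: le_trans (cmod_sum _ _ _) _.
  apply: (@le_trans _ _ (\sum_(p : 'I_N * 'I_N)
     cmod (fejer (x.1 - p.1%:R)) * cmod (fejer (x.2 - p.2%:R)))).
    apply: ler_sum => p _; rewrite !cmodM -[leRHS]mul1r ler_wpM2r //.
    by rewrite mulr_ge0 ?cmod_ge0.
  rewrite -(pair_bigA _ (fun j l : 'I_N => cmod (fejer (x.1 - j%:R)) *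
     cmod (fejer (x.2 - l%:R)))) /= -big_distrlr /=.
  have s1 t : \sum_(j < N) cmod (fejer (t - j%:R)) = 1.
    apply: (@complexI R); rewrite rmorph_sum rmorph1 -(sum_fejer t).
    by apply: eq_bigr => j _; rewrite /= cmod_fejer.
  by rewrite !s1 mulr1.
- move=> q; have dle (p : 'I_N * 'I_N) : `|dfreq p| <= 8.
    (* From [pi < 4] all [freq] lie in [[0, 8]], so the two coordinates of a frequency are at most 8
       in modulus and its length is at most [sqrt 128 < 16]. *)
    have /andP[_ p4] := pihalf_02 R; have p0 := pi_gt0 R.
    have fb (i : 'I_N) : 0 <= freq i <= 8.
      rewrite /freq; apply/andP; split; first by rewrite divr_ge0 ?mulr_ge0 ?(ltW p0).
      rewrite ler_pdivrMr ?ltr0n // ler_pM ?mulr_ge0 ?(ltW p0) ?ler_nat 1?ltnW //; lra.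
    have /andP[h1 h2] := fb p.1; have /andP[h3 h4] := fb p.2.
    by rewrite /dfreq ler_norml; apply/andP; split; lra.
  have sq (p : 'I_N * 'I_N) : dfreq p * dfreq p <= 64.
    rewrite -expr2 -real_normK ?num_real // (_ : 64 = 8 ^+ 2); last by rewrite -natrX.
    by rewrite lerXn2r ?nnegrE.
  apply: (@le_trans _ _ (Num.sqrt (16 ^+ 2))); last by rewrite sqrtr_sqr ger0_norm.
  rewrite /enorm ler_wsqrtr // /dotp /fr /=.
  apply: le_trans (lerD (sq _) (sq _)) _; rewrite -natrD -natrX ler_nat //.
- move=> j l; rewrite trig_fejer (bigD1 (j, l)) //= !fejer_nat !eqxx !mulr1.
  rewrite big1 ?addr0 // => -[i k] /= ne; rewrite !fejer_nat -natrM mulnb.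
  by move: ne; rewrite xpair_eqE eq_sym [k == l]eq_sym => /negPf ->; rewrite mulr0.
Qed.

End Fejer.

(** * Conclusion *)

(** The exponent [q = 1/2 - 1/p] is positive exactly because [p > 2], so [n^q] exceeds any
    constant. *)
Lemma sqrt_gt_powR (R : realType) (p L : R) : 2 < p ->
  exists n : nat, (0 < n)%N /\ L * (n * 2)%N%:R `^ p^-1 < Num.sqrt n%:R.
Proof.
move=> p2; have p0 : 0 < p by lra.
pose q : R := 2^-1 - p^-1.
have q0 : 0 < q by rewrite subr_gt0 ltf_pV2 ?posrE.
pose L' : R := `|L| * 2 `^ p^-1.
have L'0 : 0 <= L' by rewrite mulr_ge0 ?powR_ge0.
pose n := (Num.bound (L' `^ q^-1)).+1.
exists n; split => //.
have nL : L' `^ q^-1 < n%:R.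
  apply: lt_le_trans (archi_boundP (powR_ge0 _ _)) _; by rewrite ler_nat.
have n0 : 0 < n%:R :> R by rewrite ltr0n.
have L'n : L' < n%:R `^ q.
  have := @gt0_ltr_powR R q q0 (L' `^ q^-1) n%:R.
  rewrite !nnegrE powR_ge0 ler0n => /(_ isT isT nL).
  by rewrite -powRrM mulVf ?lt0r_neq0 // powRr1.
have -> : Num.sqrt (n%:R : R) = n%:R `^ q * n%:R `^ p^-1.
  by rewrite -powR12_sqrt ?ltW // -powRD ?subrK // (gt_eqF n0) implybT.
apply: (@le_lt_trans _ _ (L' * n%:R `^ p^-1)).
  rewrite natrM powRM ?ler0n // /L' [_ * 2 `^ _ * _]mulrAC mulrA.
  by rewrite ler_wpM2r ?powR_ge0 // ler_wpM2r ?powR_ge0 // ler_norm.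
by rewrite ltr_pM2r // powR_gt0.
Qed.

Theorem theorem4p1 (R : realType) (p : R) (hp : 2 < p)
    (w : R -> R) (hw : dyadic_window w)
    (W : int -> R * R -> complex R) (hW : dyadic_kernels w W) :
  ~ exists K : R, 0 < K /\
      forall (H : hilbertType R) (phi : R * R -> complex R)
             (A B T : {linear H -> H}),
        besov_function W phi ->
        bounded_op T ->
        bounded_op A -> self_adjoint A -> finite_rank A ->
        bounded_op B -> self_adjoint B -> finite_rank B ->
        (schatten_norm p (commutator (fcalc phi A B) T) <=
           K%:E * besov_norm W (distr_of phi) *
           maxe (schatten_norm p (commutator A T))
                (schatten_norm p (commutator B T)))%E.
Proof.
move=> [K [K0 hK]].
have [B besovB] := besov_trig hw hW.
(* The dimension is chosen after [K], which is possible since [B] does not depend on it. *)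
have [n [n0 nlt]] := sqrt_gt_powR (K * B) hp.
have p0 : 0 < p by lra.
(* The grid has side [2n] to accommodate the eigenvalues of [B]; halving an even [l] recovers the
   index of the Fourier vector. *)
pose a (j l : 'I_(n * 2)) : R[i] :=
  if odd l then 0 else cis (- (2 * pi * j%:R * (l./2)%:R / n%:R)).
have n20 : (0 < n * 2)%N by rewrite muln_gt0 n0.
have a1 j l : cmod (a j l) <= 1.
  by rewrite /a; case: ifP => _; rewrite ?cmod0 ?cmod_cis.
have [J [c [k [c1 k16 ck]]]] := fejer_interpolation n20 a1.
have [bphi nphi] := besovB J c k c1 k16.
have even (j l : 'I_n) : trig c k (j%:R, (l.*2)%:R) = (dft j l)^*.
  have jn : (j < n * 2)%N by have := ltn_ord j; lia.
  have ln : (l.*2 < n * 2)%N by have := ltn_ord l; lia.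
  rewrite (ck (Ordinal jn) (Ordinal ln)) /a /= odd_double doubleK.
  by rewrite /dft conj_cis.
have odd (j l : 'I_n) : trig c k (j%:R, (l.*2.+1)%:R) = 0.
  have jn : (j < n * 2)%N by have := ltn_ord j; lia.
  have ln : (l.*2.+1 < n * 2)%N by have := ltn_ord l; lia.
  by rewrite (ck (Ordinal jn) (Ordinal ln)) /a /= odd_double.
have [H [f [g [fP gP gf]]]] := @dft_bases R n n0.
have [A [A' [T [bT [bA sA fA] [bB sB fB] upper lower]]]] :=
  commutator_witness fP gP n0 gf even odd p0.
have := hK _ _ _ _ _ bphi bT bA sA fA bB sB fB.
(* The right-hand side is at most [K B (2n)^(1/p)], which is below [sqrt n] by the choice of [n]. *)
apply/negP; rewrite -ltNge; apply: lt_le_trans lower.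
have nn0 : (0 <= besov_norm W (distr_of (trig c k)))%E.
  apply: esum_ge0 => m _; rewrite mule_ge0 ?Lnorm_ge0 // lee_fin exprz_ge0 //.
apply: (@le_lt_trans _ _ ((K * B)%:E * ((n * 2)%N%:R `^ p^-1)%:E)%E).
  apply: lee_pmul => //.
  - by rewrite mule_ge0 // lee_fin ltW.
  - by rewrite le_max !poweR_ge0.
  - by rewrite EFinM lee_wpmul2l // lee_fin ltW.
by rewrite -EFinM lte_fin.
Qed.
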